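(* For all $A\subseteq 2^\omega$ the following are equivalent: (i) $A$ is $\Delta^1_1$ and semi-positive; (ii) $A$ admits a recursive semi-positive code; (iii) $A$ is $\Delta^1_1$ and monotone.
   Context: $\Delta^1_1$ is the lightface (effective) pointclass. $\mathcal{N}=\omega^\omega$. For a finite sequence of naturals, $\langle u_0,\dots,u_{n-1}\rangle=p_0^{u_0+1}\cdots p_{n-1}^{u_{n-1}+1}$, where $(p_n)$ enumerates the primes in increasing order, $\langle\emptyset\rangle=1$. If $s=\langle u_0,\dots,u_{n-1}\rangle$ and $i<n$ then $(s)_i=u_i$; in all other cases $(s)_i=0$. Put $q(s)=(s)_0/((s)_1+1)$. For $\alpha\in\mathcal{N}$, $\alpha^*(t)=\alpha(t+1)$. A recursive Polish space $\mathcal{X}$ (such as $\omega$, $2^\omega$, $\mathcal{N}$ and finite products) comes with a fixed complete metric $d_{\mathcal{X}}$ and a fixed recursive presentation $(r^{\mathcal{X}}_i)_{i\in\omega}$ (a dense sequence for which the relations $d(r_i,r_j)<q(k)$, $d(r_i,r_j)\le q(k)$ are recursive); finite products carry the maximum metric and $r^{\mathcal{X}_0\times\dots\times\mathcal{X}_n}_s=(r^{\mathcal{X}_0}_{(s)_0},\dots,r^{\mathcal{X}_n}_{(s)_n})$. $N(\mathcal{X},s)$ is the open ball with center $r^{\mathcal{X}}_{(s)_0}$ and radius $q((s)_1)$, and $U^{\mathcal{X}}(\alpha)=\bigcup_nN(\mathcal{X},\alpha(n))$. For $\alpha\in\mathcal{N}$, $\{\alpha\}:\omega\rightharpoonup\mathcal{N}$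 is the partial function such that $\{\alpha\}(n)$ is defined iff there is a unique $y\in\mathcal{N}$ with $y\in N(\mathcal{N},s)\iff(n,s)\in U^{\omega\times\omega}(\alpha)$ for all $s\in\omega$, and then $\{\alpha\}(n)=y$. A set $A\subseteq 2^\omega$ is semi-positive if it belongs to the least family of subsets of $2^\omega$ containing the sets $U_n=\{x:x(n)=1\}$ $(n\in\omega)$, $\emptyset$ and $2^\omega$, and closed under countable unions and countable intersections. $A$ is monotone if $x\in A$ and $\{n:x(n)=1\}\subseteq\{n:y(n)=1\}$ imply $y\in A$. Semi-positive codes: put $V_0=\emptyset$, $V_1=2^\omega$, $V_{n+2}=U_n$. $\alpha\in SPC_0$ iff $\alpha(0)=0$; for $\xi>0$, $\alpha\in SPC_\xi$ iff $\alpha(0)=1$ and for all $i,j$, $\{\alpha^*\}(\langle i,j\rangle)$ is defined and belongs to $SPC_\eta$ for some $\eta<\xi$. $SPC=\bigcup_{\xi<\omega_1}SPC_\xi$. For $\alpha\in SPC$, $\tau(\alpha)=V_{\alpha^*(1)}$ if $\alpha(0)=0$, and $\tau(\alpha)=\bigcup_i\bigcap_j\tau(\{\alpha^*\}(\langle i,j\rangle))$ if $\alpha(0)=1$. $\alpha\in SPC$ is a semi-positive code for $\tau(\alpha)$. *)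

(* Defs.v *)
From mathcomp Require Import all_boot all_order all_algebra.
From mathcomp Require Import boolp classical_sets wochoice.

Set Implicit Arguments.
Unset Strict Implicit.
Unset Printing Implicit Defensive.

Import Order.TTheory GRing.Theory Num.Theory.

Local Open Scope classical_set_scope.

Notation baire := (nat -> nat).
Notation cantor := (nat -> bool).

Lemma next_prime (m : nat) : exists p, (m < p) && prime p.
Proof. by have [p mp pp] := prime_above m; exists p; apply/andP. Qed.

Fixpoint nth_prime (n : nat) : nat :=
  if n is m.+1 then ex_minn (next_prime (nth_prime m)) else 2.

Definition seqcode (u : seq nat) : nat :=
  \prod_(i < size u) nth_prime i ^ (nth 0 u i).+1.

(* (s)_i.  Both the default [::] (s is not a code) and the default 0 of nth
   (i is out of range) give the value 0. *)
Definition entry (s i : nat) : nat :=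
  nth 0 (xget [::] [set u | seqcode u = s]) i.

Definition qrat (s : nat) : rat := ((entry s 0)%:R / (entry s 1).+1%:R)%R.

(* The total recursive functions of several arguments: the least class with
   zero, successor and projections, closed under composition, primitive
   recursion and minimalization of functions having a zero in every fibre. *)
Inductive recursive_fun : forall n : nat, (n.-tuple nat -> nat) -> Prop :=
| rec_zero : recursive_fun (fun _ : 0.-tuple nat => 0)
| rec_succ : recursive_fun (fun x : 1.-tuple nat => (thead x).+1)
| rec_proj n (i : 'I_n) : recursive_fun (fun x : n.-tuple nat => tnth x i)
| rec_comp m n (g : m.-tuple nat -> nat) (h : 'I_m -> n.-tuple nat -> nat) :
    recursive_fun g -> (forall i, recursive_fun (h i)) ->
    recursive_fun (fun x => g [tuple h i x | i < m])
| rec_prim n (g : n.-tuple nat -> nat) (h : n.+2.-tuple nat -> nat)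
    (f : n.+1.-tuple nat -> nat) :
    recursive_fun g -> recursive_fun h ->
    (forall x : n.-tuple nat, f [tuple of 0 :: x] = g x) ->
    (forall k (x : n.-tuple nat),
       f [tuple of k.+1 :: x] = h [tuple of k :: f [tuple of k :: x] :: x]) ->
    recursive_fun f
| rec_min n (g : n.+1.-tuple nat -> nat) (f : n.-tuple nat -> nat) :
    recursive_fun g ->
    (forall x : n.-tuple nat, g [tuple of f x :: x] = 0) ->
    (forall (x : n.-tuple nat) k, k < f x -> g [tuple of k :: x] <> 0) ->
    recursive_fun f.

Definition recursive (alpha : baire) : Prop :=
  recursive_fun (fun x : 1.-tuple nat => alpha (thead x)).

(* The data of a recursive Polish space.  The metrics fixed below on omega,
   2^omega, omega^omega and their products take only rational values. *)
Record presented_space := PresentedSpace {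
  carrier :> Type;
  dist : carrier -> carrier -> rat;
  rpoint : nat -> carrier }.

Definition seq_dist (T : eqType) (x y : nat -> T) : rat :=
  if pselect (exists n, x n != y n) is left h
  then ((ex_minn h).+1%:R^-1)%R else 0%R.

Definition omega_space : presented_space :=
  @PresentedSpace nat (fun m n => ((m != n)%:R)%R) id.

Definition baire_space : presented_space :=
  @PresentedSpace baire (@seq_dist nat) entry.

Definition cantor_space : presented_space :=
  @PresentedSpace cantor (@seq_dist bool) (fun s n => entry s n != 0).

Definition prod_space (X Y : presented_space) : presented_space :=
  @PresentedSpace (X * Y)
    (fun a b => Num.max (dist a.1 b.1) (dist a.2 b.2))
    (fun s => (rpoint X (entry s 0), rpoint Y (entry s 1))).

Definition nball (X : presented_space) (s : nat) : set X :=
  [set x | (dist x (rpoint X (entry s 0)) < qrat (entry s 1))%R].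

Arguments nball : clear implicits.

Definition Uopen (X : presented_space) (alpha : baire) : set X :=
  \bigcup_n nball X (alpha n).

Arguments Uopen : clear implicits.

Definition Sigma01 (X : presented_space) (A : set X) : Prop :=
  exists2 eps : baire, recursive eps & A = Uopen X eps.

Definition Pi01 (X : presented_space) (A : set X) : Prop := Sigma01 (~` A).

Definition Sigma11 (X : presented_space) (A : set X) : Prop :=
  exists2 C : set (prod_space X baire_space),
    Pi01 C & A = [set x | exists y : baire, C (x, y)].

Definition Delta11 (X : presented_space) (A : set X) : Prop :=
  Sigma11 A /\ Sigma11 (~` A).

Definition star (alpha : baire) : baire := fun t => alpha t.+1.

Definition app_graph (alpha : baire) (n : nat) : set baire :=
  [set y | forall s, nball baire_space s y <->
                     Uopen (prod_space omega_space omega_space) alpha (n, s)].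

Definition app_defined (alpha : baire) (n : nat) : Prop :=
  exists! y, app_graph alpha n y.

(* {alpha}(n); the default value is used only where it is undefined. *)
Definition app (alpha : baire) (n : nat) : baire :=
  xget (fun=> 0) (app_graph alpha n).

Definition Ucyl (n : nat) : set cantor := [set x | x n = true].

Inductive semi_positive : set cantor -> Prop :=
| sp_cyl n : semi_positive (Ucyl n)
| sp_empty : semi_positive set0
| sp_full : semi_positive setT
| sp_bigcup (B : nat -> set cantor) :
    (forall n, semi_positive (B n)) -> semi_positive (\bigcup_n B n)
| sp_bigcap (B : nat -> set cantor) :
    (forall n, semi_positive (B n)) -> semi_positive (\bigcap_n B n).

Definition monotone (A : set cantor) : Prop :=
  forall x y : cantor,
    A x -> [set n | x n = true] `<=` [set n | y n = true] -> A y.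

Definition Vset (n : nat) : set cantor :=
  match n with 0 => set0 | 1 => setT | m.+2 => Ucyl m end.

Definition strictly_below (R : rel nat) (eta xi : nat) : Prop :=
  R eta xi /\ eta <> xi.

(* SPC_xi, where the ordinal xi is the rank of an element of a well-ordering R
   of the natural numbers; 0 is the rank of the R-least element. *)
Inductive SPC_stage (R : rel nat) : nat -> set baire :=
| SPC_zero xi alpha :
    (forall eta, ~ strictly_below R eta xi) ->
    alpha 0 = 0 -> SPC_stage R xi alpha
| SPC_pos xi alpha (eta : nat -> nat -> nat) :
    (exists zeta, strictly_below R zeta xi) ->
    alpha 0 = 1 ->
    (forall i j, app_defined (star alpha) (seqcode [:: i; j])) ->
    (forall i j, strictly_below R (eta i j) xi) ->
    (forall i j,
       SPC_stage R (eta i j) (app (star alpha) (seqcode [:: i; j]))) ->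
    SPC_stage R xi alpha.

(* The countable ordinals are exactly the ranks of the elements of the
   well-orderings of the natural numbers. *)
Definition SPC : set baire :=
  [set alpha | exists R : rel nat,
     well_order R /\ exists xi, SPC_stage R xi alpha].

(* The recursion clauses tau0 and tau1 have only one solution on SPC, because
   SPC is well founded; tau is their least solution on all of baire. *)
Inductive tau : baire -> set cantor :=
| tau_base alpha x :
    alpha 0 = 0 -> Vset (star alpha 1) x -> tau alpha x
| tau_step alpha x i :
    alpha 0 = 1 ->
    (forall j, tau (app (star alpha) (seqcode [:: i; j])) x) ->
    tau alpha x.

Lemma tau0 (alpha : baire) : alpha 0 = 0 -> tau alpha = Vset (star alpha 1).
Proof.
move=> a0; apply/seteqP; split=> [x t|x Vx]; last exact: tau_base.
by case: t a0 => // b y i ->.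
Qed.

Lemma tau1 (alpha : baire) : alpha 0 = 1 ->
  tau alpha =
    \bigcup_i \bigcap_j tau (app (star alpha) (seqcode [:: i; j])).
Proof.
move=> a1; apply/seteqP; split=> [x t|x [i _ Hx]].
  by case: t a1 => [b y ->//|b y i _ Hy _]; exists i.
by apply: (tau_step (i := i)) => // j; apply: Hx.
Qed.

Definition semi_positive_code (alpha : baire) (A : set cantor) : Prop :=
  SPC alpha /\ tau alpha = A.

(* Main.v *)
Require Import Defs.
From mathcomp Require Import all_boot boolp classical_sets.
From mathcomp Require Import all_order all_algebra zify wochoice.

(* A recursive code is evaluated by guessing the codes and the truth values at
   all nodes of its tree, together with witnesses; correctness of the guess is
   a Pi^0_1 condition, and it is forced by induction on the rank of the code.
   Hence the coded set is Delta^1_1, and it is semi-positive, thus monotone.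

   Conversely let A be Delta^1_1 and monotone, A the set of the bit parts of
   the branches of a recursive tree T, and its complement that of S.  Pair the
   nodes of T and S whose bit sequences p, q satisfy p <= q.  By monotonicity
   the tree of these pairs is well founded, and bar recursion on it yields
   separators: at a pair that has died one of the sets empty, 2^omega, U_k
   separates; at a live pair take the union over the extensions i of the left
   node of the intersection over the extensions j of the right node of the
   separators at (i, j).  The code of the separator at a node is total
   recursive, uniformly in the node: as a point of Baire space it enumerates
   the balls that contain the codes of the successors, and the t-th step of
   this enumeration needs only finitely many earlier values of one of these. *)

Set Implicit Arguments.
Unset Strict Implicit.
Unset Printing Implicit Defensive.

Import Order.TTheory GRing.Theory Num.Theory.

(** * Closure properties of the recursive functions *)

Lemma recursive_fun_ext n (f g : n.-tuple nat -> nat) :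
  f =1 g -> recursive_fun f -> recursive_fun g.
Proof. by move=> /funext ->. Qed.

Definition recursive2 (F : nat -> nat -> nat) : Prop :=
  recursive_fun (fun x : 2.-tuple nat => F (tnth x ord0) (tnth x (inord 1))).

Lemma recursive_fun_comp1 n (f : nat -> nat) (g : n.-tuple nat -> nat) :
  recursive f -> recursive_fun g -> recursive_fun (fun x => f (g x)).
Proof.
move=> rf rg.
have := rec_comp (h := fun _ : 'I_1 => g) rf (fun _ => rg).
by apply: recursive_fun_ext => x; rewrite /thead tnth_mktuple.
Qed.

Lemma recursive_fun_comp2 n F (g h : n.-tuple nat -> nat) :
  recursive2 F -> recursive_fun g -> recursive_fun h ->
  recursive_fun (fun x => F (g x) (h x)).
Proof.
move=> rF rg rh.
have rgh (i : 'I_2) : recursive_fun (fun x => if i == ord0 then g x else h x).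
  by case: eqP.
have := rec_comp rF rgh.
by apply: recursive_fun_ext => x; rewrite !tnth_mktuple /= -val_eqE /= inordK.
Qed.

Lemma recursive_fun_const n c : recursive_fun (fun _ : n.-tuple nat => c).
Proof.
elim: c => [|c]; last by apply: (recursive_fun_comp1 rec_succ).
have r0 (i : 'I_0) : recursive_fun (fun _ : n.-tuple nat => 0) by case: i.
by have := rec_comp rec_zero r0.
Qed.

Lemma recursive_fun_id : recursive_fun (fun x : 1.-tuple nat => thead x).
Proof. exact: rec_proj. Qed.

(** The coordinates follow [rec_prim], whose step function receives the counter, the previous value
    and then the parameter. *)
Lemma rc2_primrec (a : nat -> nat) (h : nat -> nat -> nat -> nat) :
  recursive a ->
  recursive_fun (fun x : 3.-tuple nat =>
    h (tnth x (inord 2)) (tnth x ord0) (tnth x (inord 1))) ->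
  recursive2 (fun k n => nat_rect _ (a n) (h n) k).
Proof.
move=> ra rh; apply: rec_prim ra rh _ _ => [x|k x] /=.
  by congr a; rewrite /thead !(tnth_nth 0) /= inordK //.
rewrite !(tnth_nth 0) /= !inordK //=.
Qed.

Lemma rc2_swap F : recursive2 F -> recursive2 (fun x y => F y x).
Proof. by move=> rF; apply: recursive_fun_comp2 rF _ _; apply: rec_proj. Qed.

Lemma rc2_add : recursive2 addn.
Proof.
have := @rc2_primrec id (fun _ _ v => v.+1) recursive_fun_id.
move=> /(_ (recursive_fun_comp1 rec_succ (rec_proj _))).
apply: recursive_fun_ext => x.
by move: (tnth _ _) (tnth _ _) => k n; elim: k => //= k ->.
Qed.

Lemma rc2_mul : recursive2 muln.
Proof.
have := @rc2_primrec (fun=> 0) (fun n _ v => n + v) (recursive_fun_const 1 0).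
move=> /(_ (recursive_fun_comp2 rc2_add (rec_proj _) (rec_proj _))).
apply: recursive_fun_ext => x.
by move: (tnth _ _) (tnth _ _) => k n; elim: k => //= k ->.
Qed.

Lemma recursive_pred : recursive predn.
Proof.
have := @rc2_primrec (fun=> 0) (fun n k _ => k) (recursive_fun_const 1 0).
move=> /(_ (rec_proj _)) r.
have := recursive_fun_comp2 r recursive_fun_id (recursive_fun_const 1 0).
by apply: recursive_fun_ext => x; case: (thead x).
Qed.

Lemma rc2_sub : recursive2 subn.
Proof.
apply: (@rc2_swap (fun k n => n - k)).
have := @rc2_primrec id (fun _ _ v => v.-1) recursive_fun_id.
move=> /(_ (recursive_fun_comp1 recursive_pred (rec_proj _))).
apply: recursive_fun_ext => x.
move: (tnth _ _) (tnth _ _) => k n.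
by elim: k => [|k IH]; rewrite ?subn0 // subnS -IH.
Qed.

(* [pr] is injective but not onto; outside its range, [p2] truncates. *)
Definition pr (a b : nat) : nat := (a + b) * (a + b) + a.

Lemma ex_sqrt (n : nat) : exists w, n < w.+1 * w.+1.
Proof. by exists n; apply: leq_pmulr. Qed.

(** [pr a b] lies between the consecutive squares of [a + b] and [a + b + 1], so the integer square
    root recovers [a + b], and from it [a] and [b]. *)
Definition sqrtn (n : nat) : nat := ex_minn (ex_sqrt n).
Definition p1 (n : nat) : nat := n - sqrtn n * sqrtn n.
Definition p2 (n : nat) : nat := sqrtn n - p1 n.

Lemma sqrtnP n : sqrtn n * sqrtn n <= n < (sqrtn n).+1 * (sqrtn n).+1.
Proof.
rewrite /sqrtn; case: ex_minnP => -[|w] //= nw min_w; rewrite nw andbT.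
by rewrite leqNgt; apply/negP => /min_w; rewrite ltnn.
Qed.

Lemma sqrtn_pr a b : sqrtn (pr a b) = a + b.
Proof.
have /andP[] := sqrtnP (pr a b); move: (sqrtn _) => w.
rewrite /pr; nia.
Qed.

Lemma p1_pr a b : p1 (pr a b) = a.
Proof. by rewrite /p1 sqrtn_pr /pr addKn. Qed.

Lemma p2_pr a b : p2 (pr a b) = b.
Proof. by rewrite /p2 sqrtn_pr p1_pr addKn. Qed.

Lemma p2_le n : p2 n <= n.
Proof.
rewrite /p2 leq_subLR (leq_trans _ (leq_addl _ _)) //.
have /andP[h _] := sqrtnP n; apply: leq_trans h; case: (sqrtn n) => // w.
exact: leq_pmulr.
Qed.

Lemma pr_le a a' b b' : a <= a' -> b <= b' -> pr a b <= pr a' b'.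
Proof. by move=> ha hb; rewrite /pr leq_add // leq_mul // leq_add. Qed.

Lemma le_pr2 a b : b <= pr a b.
Proof. by rewrite -{1}(p2_pr a b) p2_le. Qed.

(** * Unary recursive functions and predicates *)

Lemma rc_const c : recursive (fun=> c).
Proof. exact: recursive_fun_const. Qed.

Lemma rc_id : recursive (fun n => n).
Proof. exact: recursive_fun_id. Qed.

Lemma rc_comp f g : recursive f -> recursive g -> recursive (fun n => f (g n)).
Proof. exact: recursive_fun_comp1. Qed.

Lemma rc_comp_rc2 F f g :
  recursive2 F -> recursive f -> recursive g ->
  recursive (fun n => F (f n) (g n)).
Proof. exact: recursive_fun_comp2. Qed.

Lemma rc_succ f : recursive f -> recursive (fun n => (f n).+1).
Proof. exact: (rc_comp rec_succ). Qed.

Lemma rc_pred f : recursive f -> recursive (fun n => (f n).-1).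
Proof. exact: (rc_comp recursive_pred). Qed.

Lemma rc_add f g : recursive f -> recursive g -> recursive (fun n => f n + g n).
Proof. exact: (rc_comp_rc2 rc2_add). Qed.

Lemma rc_mul f g : recursive f -> recursive g -> recursive (fun n => f n * g n).
Proof. exact: (rc_comp_rc2 rc2_mul). Qed.

Lemma rc_sub f g : recursive f -> recursive g -> recursive (fun n => f n - g n).
Proof. exact: (rc_comp_rc2 rc2_sub). Qed.

Lemma rc_pr f g : recursive f -> recursive g -> recursive (fun n => pr (f n) (g n)).
Proof. by move=> rf rg; apply: rc_add => //; apply: rc_mul; apply: rc_add. Qed.

Definition recursiveb (b : nat -> bool) : Prop :=
  recursive (fun n => nat_of_bool (b n)).

Definition recursiveb2 (P : nat -> nat -> bool) : Prop :=
  recursive2 (fun m n => nat_of_bool (P m n)).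

Lemma rb_comp_rb2 P f g :
  recursiveb2 P -> recursive f -> recursive g ->
  recursiveb (fun n => P (f n) (g n)).
Proof. exact: rc_comp_rc2. Qed.

Lemma rb_leq f g : recursive f -> recursive g -> recursiveb (fun n => f n <= g n).
Proof.
move=> rf rg; have := rc_sub (rc_const 1) (rc_sub rf rg).
by apply: recursive_fun_ext => x; case: (leqP (f _)) => /=; lia.
Qed.

Lemma rb_not b : recursiveb b -> recursiveb (fun n => ~~ b n).
Proof.
move=> rb_b; have := rc_sub (rc_const 1) rb_b.
by apply: recursive_fun_ext => x; case: (b _).
Qed.

Lemma rb_and a b : recursiveb a -> recursiveb b -> recursiveb (fun n => a n && b n).
Proof.
move=> ra rb_b; have := rc_mul ra rb_b.
by apply: recursive_fun_ext => x; case: (a _); case: (b _).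
Qed.

Lemma rb_or a b : recursiveb a -> recursiveb b -> recursiveb (fun n => a n || b n).
Proof.
move=> ra rb_b; have := rb_not (rb_and (rb_not ra) (rb_not rb_b)).
by apply: recursive_fun_ext => x; case: (a _); case: (b _).
Qed.

Lemma rb_implb a b :
  recursiveb a -> recursiveb b -> recursiveb (fun n => a n ==> b n).
Proof.
move=> ra rb_b; have := rb_or (rb_not ra) rb_b.
by apply: recursive_fun_ext => x; case: (a _); case: (b _).
Qed.

Lemma rb_eqb a b : recursiveb a -> recursiveb b -> recursiveb (fun n => a n == b n).
Proof.
move=> ra rb_b; have := rb_and (rb_leq ra rb_b) (rb_leq rb_b ra).
by apply: recursive_fun_ext => x; case: (a _); case: (b _).
Qed.

Lemma rb_eqn f g : recursive f -> recursive g -> recursiveb (fun n => f n == g n).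
Proof.
move=> rf rg; have := rb_and (rb_leq rf rg) (rb_leq rg rf).
by apply: recursive_fun_ext => x; rewrite -eqn_leq.
Qed.

Lemma rc_if b f g : recursiveb b -> recursive f -> recursive g ->
  recursive (fun n => if b n then f n else g n).
Proof.
move=> rb_b rf rg; have := rc_add (rc_mul rb_b rf) (rc_mul (rb_not rb_b) rg).
by apply: recursive_fun_ext => x; case: (b _); rewrite /= ?mul1n ?mul0n ?addn0.
Qed.

Lemma rc2_pr : recursive2 pr.
Proof.
have r := recursive_fun_comp2 rc2_add (@rec_proj 2 ord0) (@rec_proj 2 (inord 1)).
exact: recursive_fun_comp2 rc2_add (recursive_fun_comp2 rc2_mul r r) (rec_proj _).
Qed.

(** Leads from binary functions to unary ones, the form of goal that [prove_rc] decomposes. *)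
Lemma rc2_uncurried F : recursive (fun q => F (p1 q) (p2 q)) -> recursive2 F.
Proof.
move=> /recursive_fun_comp1 /(_ rc2_pr).
by apply: recursive_fun_ext => x; rewrite p1_pr p2_pr.
Qed.

Lemma rc_min (P : nat -> nat -> bool) (g : nat -> nat) :
  recursiveb2 P -> (forall n, P n (g n)) ->
  (forall n k, P n k -> g n <= k) -> recursive g.
Proof.
move=> rP Pg min_g.
(* [rec_min] looks for a zero, so truth of [P] is turned into the value 0. *)
have rQ : recursive2 (fun k n => 1 - P n k).
  exact: recursive_fun_comp2 rc2_sub (recursive_fun_const _ _) (rc2_swap rP).
apply: (rec_min rQ) => [x|x k] /=.
  by rewrite /thead !(tnth_nth 0) /= inordK //= Pg.
rewrite /thead !(tnth_nth 0) /= inordK //=.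
case: (P _ k) / boolP => [/min_g h1|] // h2.
by rewrite ltnNge h1 in h2.
Qed.

Lemma rc_sqrtn f : recursive f -> recursive (fun n => sqrtn (f n)).
Proof.
apply: (rc_comp (f := sqrtn)).
apply: (@rc_min (fun n w => n < w.+1 * w.+1)) => [|n|n k h].
- apply: recursive_fun_ext (recursive_fun_comp2 rc2_sub (recursive_fun_const _ 1)
    (recursive_fun_comp2 rc2_sub (recursive_fun_comp1 rec_succ (rec_proj ord0))
      (recursive_fun_comp2 rc2_mul
         (recursive_fun_comp1 rec_succ (rec_proj (inord 1)))
         (recursive_fun_comp1 rec_succ (rec_proj (inord 1)))))) => x.
  by case: ltnP; lia.
- by have /andP[] := sqrtnP n.
- by rewrite /sqrtn; case: ex_minnP => w _; apply.
Qed.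

Lemma rc_p1 f : recursive f -> recursive (fun n => p1 (f n)).
Proof. by move=> rf; apply: rc_sub => //; apply: rc_mul; apply: rc_sqrtn. Qed.

Lemma rc_p2 f : recursive f -> recursive (fun n => p2 (f n)).
Proof. by move=> rf; apply: rc_sub; [apply: rc_sqrtn|apply: rc_p1]. Qed.

Lemma rc_rec a h b : recursive a -> recursive b ->
  recursive (fun q => h (p1 (p1 q)) (p2 (p1 q)) (p2 q)) ->
  recursive (fun n => nat_rect (fun=> nat) (a n) (h n) (b n)).
Proof.
move=> ra rb_ rh.
have r : recursive2 (fun k n => nat_rect (fun=> nat) (a n) (h n) k).
  apply: rc2_primrec ra _.
  have r2 := recursive_fun_comp2 rc2_pr (@rec_proj 3 (inord 2)) (@rec_proj 3 ord0).
  have r3 := recursive_fun_comp2 rc2_pr r2 (rec_proj (inord 1)).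
  have := recursive_fun_comp1 rh r3.
  by apply: recursive_fun_ext => x; rewrite !(p1_pr, p2_pr).
exact: rc_comp_rc2 r rb_ rc_id.
Qed.

Definition bforall (B : nat) (P : nat -> bool) : bool := all P (iota 0 B).

Lemma bforallP B (P : nat -> bool) : reflect (forall k, k < B -> P k) (bforall B P).
Proof.
apply: (iffP allP) => h k; first by move=> kB; apply: h; rewrite mem_iota.
by rewrite mem_iota => /andP[_ ]; apply: h.
Qed.

Lemma bforallS B P : bforall B.+1 P = bforall B P && P B.
Proof. by rewrite /bforall -addn1 iotaD all_cat /= andbT. Qed.

Lemma rb_bforall B (P : nat -> nat -> bool) :
  recursive B -> recursiveb (fun q => P (p1 q) (p2 q)) ->
  recursiveb (fun n => bforall (B n) (P n)).
Proof.
move=> rB rP.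
have := rc_rec (rc_const 1) rB (h := fun n k v => v * P n k).
move=> /(_ (rc_mul (rc_p2 rc_id) (rc_comp rP (rc_p1 rc_id)))).
apply: recursive_fun_ext => x; move: (thead x) => n.
by elim: (B n) => [//|m IH]; rewrite bforallS -mulnb -IH.
Qed.

(** A hook of [prove_rc], redefined whenever further closure properties become available. *)
Ltac prove_rc_more := fail.

Ltac prove_rc :=
  repeat first
  [ assumption | prove_rc_more | exact: rc_const | exact: rc_id
  | exact: (rc_p1 rc_id) | exact: (rc_p2 rc_id)
  | match goal with
    | |- recursiveb (fun n => @?a n && @?b n) => apply: (@rb_and a b)
    | |- recursiveb (fun n => @?a n || @?b n) => apply: (@rb_or a b)
    | |- recursiveb (fun n => @?a n ==> @?b n) => apply: (@rb_implb a b)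
    | |- recursiveb (fun n => ~~ @?a n) => apply: (@rb_not a)
    | |- recursiveb (fun n => @?a n <= @?b n) => apply: (@rb_leq a b)
    | |- recursiveb (fun n => @?a n == @?b n) =>
        first [apply: (@rb_eqn a b) | apply: (@rb_eqb a b)]
    | |- recursiveb (fun n => bforall (@?B n) (@?P n)) => apply: (@rb_bforall B P)
    | |- recursive (fun n => nat_of_bool (@?b n)) => change (recursiveb b)
    | |- recursive (fun n => (@?a n).+1) => apply: (@rc_succ a)
    | |- recursive (fun n => (@?a n).-1) => apply: (@rc_pred a)
    | |- recursive (fun n => @?a n + @?b n) => apply: (@rc_add a b)
    | |- recursive (fun n => @?a n * @?b n) => apply: (@rc_mul a b)
    | |- recursive (fun n => @?a n - @?b n) => apply: (@rc_sub a b)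
    | |- recursive (fun n => pr (@?a n) (@?b n)) => apply: (@rc_pr a b)
    | |- recursive (fun n => p1 (@?a n)) => apply: (@rc_p1 a)
    | |- recursive (fun n => p2 (@?a n)) => apply: (@rc_p2 a)
    | |- recursive (fun n => if _ then _ else _) => apply: rc_if
    | H : forall f, recursive f -> recursive (fun n => ?F (f n))
      |- recursive (fun n => ?F (@?a n)) => apply: (H a)
    | H : forall f, recursive f -> recursiveb (fun n => ?F (f n))
      |- recursiveb (fun n => ?F (@?a n)) => apply: (H a)
    | H : recursiveb2 ?F |- recursiveb (fun n => ?F (@?a n) (@?b n)) =>
        apply: (@rb_comp_rb2 F a b H)
    | H : recursive ?F |- recursive (fun n => ?F (@?a n)) => apply: (@rc_comp F a H)
    | H : recursive2 ?F |- recursive (fun n => ?F (@?a n) (@?b n)) =>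
        apply: (@rc_comp_rc2 F a b H)
    end ].

Lemma rc_expn f g : recursive f -> recursive g -> recursive (fun n => f n ^ g n).
Proof.
move=> rf rg.
have := rc_rec (rc_const 1) rg (h := fun n k v => f n * v).
move=> /(_ ltac:(prove_rc)).
apply: recursive_fun_ext => x; move: (thead x) => n.
by elim: (g n) => //= m ->; rewrite expnS.
Qed.

Lemma rb_dvdn f g : recursive f -> recursive g -> recursiveb (fun n => f n %| g n).
Proof.
move=> rf rg.
have : recursiveb (fun n => ~~ bforall (g n).+1 (fun k => ~~ (k * f n == g n))).
  by prove_rc.
apply: recursive_fun_ext => x; congr (nat_of_bool _).
move: (f _) (g _) => d n; apply/idP/idP => [|/dvdnP[k ->]].
  apply: contraNT => dn; apply/bforallP => k _; apply: contraNN dn => /eqP <-.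
  exact: dvdn_mull.
(* For [d = 0] the quotient [k] may exceed the bound of the search; there 0 serves. *)
apply/bforallP => /(_ (if d == 0 then 0 else k)); case: eqP => [->|/eqP d0].
  by rewrite !muln0 eqxx => /(_ isT).
by rewrite eqxx ltnS leq_pmulr ?lt0n // => /(_ isT).
Qed.

Lemma rb_prime f : recursive f -> recursiveb (fun n => prime (f n)).
Proof.
move=> rf; have : recursiveb (fun n => (1 < f n) &&
    bforall (f n) (fun d => (1 < d) ==> ~~ (d %| f n))).
  by prove_rc; apply: (@rb_dvdn p2); prove_rc.
apply: recursive_fun_ext => x; congr (nat_of_bool _).
move: (f _) => n; apply/andP/primeP => [[n1 /bforallP h]|[n1 h]]; split=> //.
  move=> d dn; have := dvdn_leq (ltnW n1) dn.
  rewrite leq_eqVlt => /orP[-> /[!orbT] //|/h].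
  rewrite dn implybF -leqNgt; case: d dn => [|[|//]] //.
  by rewrite dvd0n => /eqP n0; rewrite n0 in n1.
apply/bforallP => d dn; apply/implyP => d1; apply/negP => /h.
by rewrite (gtn_eqF d1) (ltn_eqF dn).
Qed.

Ltac prove_rc_more ::= match goal with
  | |- recursive (fun n => @?a n ^ @?b n) => apply: (@rc_expn a b)
  | |- recursiveb (fun n => @?a n %| @?b n) => apply: (@rb_dvdn a b)
  | |- recursiveb (fun n => prime (@?a n)) => apply: (@rb_prime a)
  end.

(** * Prime codes of finite sequences *)

Lemma nth_prime_prime n : prime (nth_prime n).
Proof. by case: n => //= n; case: ex_minnP => p /andP[]. Qed.

Lemma nth_prime_mono m n : m < n -> nth_prime m < nth_prime n.
Proof.
elim: n => // n IH; rewrite ltnS leq_eqVlt => h.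
have lt : nth_prime n < nth_prime n.+1 by rewrite /=; case: ex_minnP => p /andP[].
by case/orP: h => [/eqP -> //|/IH /ltn_trans ->].
Qed.

Lemma nth_prime_inj : injective nth_prime.
Proof.
move=> m n e; apply/eqP; case: ltngtP => // /nth_prime_mono; by rewrite e ltnn.
Qed.

Lemma rc_nth_prime f : recursive f -> recursive (fun n => nth_prime (f n)).
Proof.
apply: (rc_comp (f := nth_prime)).
have rnext : recursive (fun p => ex_minn (next_prime p)).
  apply: (@rc_min (fun m p => (m < p) && prime p)) => [|n|n k].
  - by apply: rc2_uncurried; prove_rc.
  - by case: ex_minnP.
  - by case: ex_minnP => p _; apply.
have := rc_rec (rc_const 2) rc_id (h := fun n k v => ex_minn (next_prime v)).
by move=> /(_ (rc_comp rnext (rc_p2 rc_id))).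
Qed.

Lemma rc_sum f B : recursive (fun q => f (p1 q) (p2 q)) -> recursive B ->
  recursive (fun n => \sum_(0 <= k < B n) f n k).
Proof.
move=> rf rB; have := rc_rec (rc_const 0) rB (h := fun n k v => v + f n k).
move=> /(_ (rc_add (rc_p2 rc_id) (rc_comp rf (rc_p1 rc_id)))).
apply: recursive_fun_ext => x; move: (thead x) => n.
by elim: (B n) => [|m IH]; [rewrite big_geq|rewrite big_nat_recr //= -IH].
Qed.

Lemma rc_prod f B : recursive (fun q => f (p1 q) (p2 q)) -> recursive B ->
  recursive (fun n => \prod_(0 <= k < B n) f n k).
Proof.
move=> rf rB; have := rc_rec (rc_const 1) rB (h := fun n k v => v * f n k).
move=> /(_ (rc_mul (rc_p2 rc_id) (rc_comp rf (rc_p1 rc_id)))).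
apply: recursive_fun_ext => x; move: (thead x) => n.
by elim: (B n) => [|m IH]; [rewrite big_geq|rewrite big_nat_recr //= -IH].
Qed.

(** The exponent of a prime counts the powers of it that divide the number, which is a bounded
    sum. *)
Lemma rc_logn f g : recursive f -> recursive g -> (forall n, prime (f n)) ->
  recursive (fun n => logn (f n) (g n)).
Proof.
move=> rf rg pf.
have : recursive (fun n => \sum_(0 <= k < (g n).-1) (f n ^ k.+1 %| g n)).
  by apply: rc_sum; prove_rc.
apply: recursive_fun_ext => x; move: (thead x) => n.
by rewrite logn_count_dvd // big_add1.
Qed.

Lemma seqcode_gt0 u : 0 < seqcode u.
Proof.
by rewrite /seqcode prodn_gt0 // => i; rewrite expn_gt0 prime_gt0 ?nth_prime_prime.
Qed.

Lemma logn_seqcode u i :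
  logn (nth_prime i) (seqcode u) = if i < size u then (nth 0 u i).+1 else 0.
Proof.
have -> : logn (nth_prime i) (seqcode u) =
  \sum_(j < size u) (if i == j then (nth 0 u j).+1 else 0).
  rewrite /seqcode.
  (* Positivity is carried along because valuations add up only over nonzero factors. *)
  pose P (a b : nat) := 0 < a /\ logn (nth_prime i) a = b.
  suff [] : P (\prod_(j < size u) nth_prime j ^ (nth 0 u j).+1)
    (\sum_(j < size u) (if i == j then (nth 0 u j).+1 else 0)) by [].
  apply: (big_ind2 P) => [|a b c d [a0 la] [c0 lc]|j _]; first by rewrite /P logn1.
    by rewrite /P muln_gt0 a0 c0 lognM // la lc.
  rewrite /P expn_gt0 prime_gt0 ?nth_prime_prime //.
  rewrite lognX logn_prime ?nth_prime_prime //.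
  rewrite (inj_eq nth_prime_inj); split=> //.
  by case: (i == j); rewrite ?muln1 ?muln0.
case: ltnP => h; last first.
  by rewrite big1 // => j _; rewrite gtn_eqF // (leq_trans (ltn_ord j)).
rewrite (bigD1 (Ordinal h)) //= eqxx big1 ?addn0 // => j.
by rewrite -val_eqE /= eq_sym => /negbTE ->.
Qed.

Lemma seqcode_inj : injective seqcode.
Proof.
move=> u v e; have l i := logn_seqcode u i.
have sz : size u = size v.
  apply/eqP; rewrite eqn_leq; apply/andP; split; rewrite leqNgt; apply/negP => h.
    by have := l (size v); rewrite h e logn_seqcode ltnn.
  by have := l (size u); rewrite ltnn e logn_seqcode h.
apply: (@eq_from_nth _ 0) => // i iu.
by have := l i; rewrite e logn_seqcode -sz iu => -[].
Qed.

Lemma entry_seqcode u i : entry (seqcode u) i = nth 0 u i.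
Proof.
rewrite /entry; case: xgetP => [v _ /= /seqcode_inj -> //|].
by move=> /(_ u) [].
Qed.

(** A bounded test: the length [n] of a sequence is below its code, and the entries are read off the
    valuations. The existential over [n] is a negated [bforall]. *)
Definition is_seqcode (s : nat) : bool :=
  ~~ bforall s.+1 (fun n =>
     ~~ ((\prod_(0 <= i < n) nth_prime i ^ logn (nth_prime i) s == s) &&
         bforall n (fun i => 0 < logn (nth_prime i) s))).

Lemma ltn_size_seqcode u : size u < seqcode u.
Proof.
apply: leq_trans (ltn_expl _ (isT : 1 < 2)) _.
rewrite /seqcode -[X in 2 ^ X]card_ord -prod_nat_const.
apply: leq_prod => i _; apply: leq_trans (leq_pexp2l _ (isT : 1 <= _.+1)).
  by rewrite expn1 prime_gt1 ?nth_prime_prime.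
by rewrite prime_gt0 ?nth_prime_prime.
Qed.

Lemma is_seqcodeP s : reflect (exists u, seqcode u = s) (is_seqcode s).
Proof.
have E u n : seqcode (mkseq u n) = \prod_(0 <= i < n) nth_prime i ^ (u i).+1.
  rewrite /seqcode size_mkseq big_mkord; apply: eq_bigr => i _.
  by rewrite nth_mkseq.
apply: (iffP idP) => [|[u <-]].
  rewrite /is_seqcode => /negP h.
  have [n /andP[/eqP e /bforallP h2]] : exists n,
    (\prod_(0 <= i < n) nth_prime i ^ logn (nth_prime i) s == s) &&
         bforall n (fun i => 0 < logn (nth_prime i) s).
    apply: contrapT => nh; apply: h; apply/bforallP => n _; apply/negP => hn.
    by apply: nh; exists n.
  exists (mkseq (fun i => (logn (nth_prime i) s).-1) n).
  rewrite E -[RHS]e; apply: eq_big_nat => i /andP[_ /h2 h3].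
  by rewrite prednK.
apply/negP => /bforallP /(_ (size u)); rewrite ltnS ltnW ?ltn_size_seqcode //.
move=> /(_ isT) /negP; apply; apply/andP; split.
  rewrite -{3}(mkseq_nth 0 u) E; apply/eqP; apply: eq_big_nat => i /andP[_ h].
  by rewrite logn_seqcode h.
by apply/bforallP => i h; rewrite logn_seqcode h.
Qed.

(** Replaces the choice operator in [entry] by a computation; the predecessor undoes the shift of
    the exponents. *)
Lemma entryE s i :
  entry s i = if is_seqcode s then (logn (nth_prime i) s).-1 else 0.
Proof.
case: is_seqcodeP => [[u <-]|h].
  by rewrite entry_seqcode logn_seqcode; case: ltnP => // /(nth_default 0).
rewrite /entry; case: xgetP => [u _ /= uE|_]; last by rewrite nth_nil.
by case: h; exists u.
Qed.

Lemma entry_le s i : entry s i <= s.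
Proof.
rewrite entryE; case: is_seqcodeP => // -[u <-].
rewrite logn_seqcode; case: ltnP => //= iu.
have := dvdn_leq (seqcode_gt0 u) (pfactor_dvdnn (nth_prime i) (seqcode u)).
rewrite logn_seqcode iu; apply: leq_trans; apply: ltnW; apply: ltnW.
by apply: ltn_expl; rewrite prime_gt1 ?nth_prime_prime.
Qed.

Lemma entry_ge s i : s <= i -> entry s i = 0.
Proof.
rewrite entryE; case: is_seqcodeP => // -[u <-] si; rewrite logn_seqcode.
by rewrite ltnNge (leq_trans (ltnW (ltn_size_seqcode u)) si).
Qed.

Lemma rc_entry f g : recursive f -> recursive g ->
  recursive (fun n => entry (f n) (g n)).
Proof.
apply: rc_comp_rc2; apply: rc2_uncurried.
have H := rc_nth_prime.
have L a b : recursive a -> recursive b ->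
    recursive (fun q => logn (nth_prime (a q)) (b q)).
  by move=> ra rb_; apply: rc_logn => [||n]; prove_rc; exact: nth_prime_prime.
have Pr B b : recursive B -> recursive b ->
    recursive (fun q => \prod_(0 <= i < B q) nth_prime i ^ logn (nth_prime i) (b q)).
  move=> rB rb_; apply: rc_prod => //; apply: rc_expn; first by prove_rc.
  by apply: (L p2 (fun q => b (p1 q))); prove_rc.
have : recursive (fun q => if is_seqcode (p1 q)
                           then (logn (nth_prime (p2 q)) (p1 q)).-1 else 0).
  rewrite /is_seqcode; prove_rc.
  1-3: first [by apply: Pr; prove_rc | by apply: L; prove_rc].
by apply: recursive_fun_ext => x; rewrite entryE.
Qed.

Lemma seqcode2 a b :
  seqcode [:: a; b] = nth_prime 0 ^ a.+1 * nth_prime 1 ^ b.+1.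
Proof. by rewrite /seqcode big_ord_recl big_ord1. Qed.

Lemma rc_seqcode2 f g : recursive f -> recursive g ->
  recursive (fun n => seqcode [:: f n; g n]).
Proof.
move=> rf rg.
have : recursive (fun n => nth_prime 0 ^ (f n).+1 * nth_prime 1 ^ (g n).+1).
  by prove_rc; apply: rc_expn; prove_rc.
by apply: recursive_fun_ext => x; rewrite seqcode2.
Qed.

(** Appends [i] to the sequence of length [n] with code [p]; the length determines the prime of the
    new factor. *)
Definition snoc (n p i : nat) : nat := p * nth_prime n ^ i.+1.

Lemma seqcode_rcons u i : seqcode (rcons u i) = snoc (size u) (seqcode u) i.
Proof.
rewrite /snoc /seqcode size_rcons big_ord_recr /= nth_rcons ltnn eqxx.
by congr (_ * _); apply: eq_bigr => j _; rewrite nth_rcons ltn_ord.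
Qed.

Lemma seqcode_mkseqS z n :
  seqcode (mkseq z n.+1) = snoc n (seqcode (mkseq z n)) (z n).
Proof. by rewrite mkseqS seqcode_rcons size_mkseq. Qed.

Lemma entry_mkseq z n k : k < n -> entry (seqcode (mkseq z n)) k = z k.
Proof. by move=> kn; rewrite entry_seqcode nth_mkseq. Qed.

Lemma rc_snoc f g h : recursive f -> recursive g -> recursive h ->
  recursive (fun n => snoc (f n) (g n) (h n)).
Proof.
move=> rf rg rh; apply: rc_mul => //.
by apply: rc_expn; [exact: rc_nth_prime|prove_rc].
Qed.

Ltac prove_rc_more ::= match goal with
  | |- recursive (fun n => entry (@?a n) (@?b n)) => apply: (@rc_entry a b)
  | |- recursive (fun n => seqcode [:: @?a n; @?b n]) => apply: (@rc_seqcode2 a b)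
  | |- recursive (fun n => snoc (@?a n) (@?b n) (@?c n)) => apply: (@rc_snoc a b c)
  | |- recursiveb (fun n => @?a n < @?b n) => apply: (@rb_leq (fun n => (a n).+1) b)
  end.

(* A function whose value at [e] is determined by its values at the finitely
   many arguments [c e k], of smaller rank, is recursive: its value is read off
   the least finite table of values that is closed under the calls. *)
Lemma rc_wf (F ell mu : nat -> nat) (c St : nat -> nat -> nat) :
  recursive ell -> recursive2 c -> recursive2 St ->
  (forall e k, k < ell e -> mu (c e k) < mu e) ->
  (forall e w, (forall k, k < ell e -> entry w (c e k) = (F (c e k)).+1) ->
     St e w = F e) ->
  recursive F.
Proof.
move=> rell rcc rSt mu_c StF.
(* Entry 0 marks an argument absent from the table, so values are stored increased by one. *)
pose H w := bforall w (fun e => (0 < entry w e) ==>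
  ((entry w e == (St e w).+1) &&
   bforall (ell e) (fun k => 0 < entry w (c e k)))).
have HF w e : H w -> 0 < entry w e -> entry w e = (F e).+1.
  move=> /bforallP Hw; have [m] := ubnP (mu e); elim: m e => // m IH e me we.
  have ew : e < w by rewrite ltnNge; apply/negP => /entry_ge h; rewrite h in we.
  have /andP[/eqP -> /bforallP ck] := implyP (Hw e ew) we.
  rewrite StF // => k /[dup] kl /ck; apply: IH.
  by apply: leq_trans (mu_c _ _ kl) _.
(* The closure of [e] under calls is finite, since every argument issues finitely many calls and
   ranks decrease. *)
have exD e : exists D : seq nat, e \in D /\
    forall d, d \in D -> forall k, k < ell d -> c d k \in D.
  have [m] := ubnP (mu e); elim: m e => // m IH e me.
  have /choice[D HD] : forall k, exists D : seq nat, k < ell e ->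
    c e k \in D /\ forall d, d \in D -> forall k, k < ell d -> c d k \in D.
    move=> k; have [kl|kl] := ltnP k (ell e); last by exists [::].
    have [|D HD] := IH (c e k); last by exists D.
    by apply: leq_trans (mu_c _ _ kl) _.
  exists (e :: flatten [seq D k | k <- iota 0 (ell e)]).
  split=> [|d]; first by rewrite inE eqxx.
  rewrite inE => /orP[/eqP -> k kl|/flatten_mapP[k]].
    rewrite inE; apply/orP; right; apply/flatten_mapP; exists k.
      by rewrite mem_iota.
    by have [] := HD k kl.
  rewrite mem_iota => /= kl dD j jl; rewrite inE; apply/orP; right.
  apply/flatten_mapP; exists k; first by rewrite mem_iota.
  by have [_] := HD k kl; apply.
have exw e : exists w, H w && (0 < entry w e).
  have [D [eD Dc]] := exD e.
  pose N := (sumn D).+1.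
  have DN d : d \in D -> d < N.
    rewrite ltnS; elim: (D) => // a D' IH; rewrite inE /=.
    by case/orP => [/eqP ->|/IH h]; rewrite ?leq_addr // (leq_trans h) ?leq_addl.
  pose w := seqcode (mkseq (fun d => if d \in D then (F d).+1 else 0) N).
  have wE d : entry w d = if d \in D then (F d).+1 else 0.
    have [dN|dN] := ltnP d N; first by rewrite entry_mkseq.
    rewrite entry_seqcode nth_default ?size_mkseq //.
    by case: ifP => // /DN; rewrite ltnNge dN.
  exists w; rewrite wE eD andbT; apply/bforallP => d _; rewrite wE.
  case: ifP => //= dD; apply/andP; split.
    by rewrite StF // => k kl; rewrite wE Dc.
  by apply/bforallP => k kl; rewrite wE Dc.
pose G e := ex_minn (exw e).
have rG : recursive G.
  apply: (@rc_min (fun e w => H w && (0 < entry w e))) => [|e|e k].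
  - by apply: rc2_uncurried; rewrite /H; prove_rc.
  - by rewrite /G; case: ex_minnP.
  - by rewrite /G; case: ex_minnP => w _; apply.
have : recursive (fun e => (entry (G e) e).-1) by prove_rc.
apply: recursive_fun_ext => x; move: (thead x) => e.
by rewrite /G; case: ex_minnP => w /andP[Hw we] _; rewrite (HF w).
Qed.

(** * Balls and effective pointclasses *)

Local Open Scope classical_set_scope.

(* [x] lies in the ball of radius [qrat e] around [y], for sequences. *)
Definition close (T : eqType) (e : nat) (x y : nat -> T) : bool :=
  (0 < entry e 0) && bforall e.+1 (fun k =>
    (entry e 0 * k.+1 <= (entry e 1).+1) ==> (x k == y k)).

(** The bound [e.+1] in [close] loses nothing: for a positive numerator the premise forces [k] to be
    at most [entry e 1], hence at most [e]. *)
Lemma closeP (T : eqType) e (x y : nat -> T) :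
  reflect (0 < entry e 0 /\
           forall k, entry e 0 * k.+1 <= (entry e 1).+1 -> x k = y k)
          (close e x y).
Proof.
apply: (iffP andP) => -[a0 h]; split=> //.
  move=> k hk; apply/eqP; apply: (implyP (bforallP _ _ h k _) hk).
  by have := leq_trans (leq_pmull k.+1 a0) hk; have := entry_le e 1; lia.
by apply/bforallP => k _; apply/implyP => /h ->.
Qed.

Lemma close_eq (T : eqType) e (x x' y y' : nat -> T) :
  (forall k, k <= e -> x k = x' k) -> (forall k, k <= e -> y k = y' k) ->
  close e x y = close e x' y'.
Proof.
move=> hx hy; rewrite /close; congr andb; rewrite /bforall; apply: eq_in_all.
by move=> k; rewrite mem_iota /= ltnS => ke; rewrite hx // hy.
Qed.

(** If [n] is the first difference, 1/(n+1) < a/(b+1) means b+1 < a(n+1); thus all [k] with a(k+1)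
    <= b+1 must come before [n]. For a = 0 the ball is empty. *)
Lemma seq_dist_lt (T : eqType) e (x y : nat -> T) :
  (seq_dist x y < qrat e)%R = close e x y.
Proof.
rewrite /seq_dist /qrat; case: pselect => [xy|nxy].
  case: ex_minnP => n xn min_n; rewrite ltr_pdivlMr ?ltr0n // mulrC.
  rewrite ltr_pdivrMr ?ltr0n // -natrM ltr_nat; apply/idP/closeP => [h|[a0 h]].
    split=> [|k hk]; first by case: (entry e 0) h.
    apply/eqP; apply/negPn/negP => /min_n; nia.
  by rewrite ltnNge; apply/negP => /h e'; rewrite e' eqxx in xn.
rewrite ltr_pdivlMr ?ltr0n // mul0r ltr0n; apply/idP/closeP => [h|[]//].
by split=> // k _; apply/eqP/negPn/negP => xk; apply: nxy; exists k.
Qed.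

Lemma nball_baireE s y :
  nball baire_space s y <-> close (entry s 1) y (entry (entry s 0)).
Proof. by rewrite /nball /= seq_dist_lt. Qed.

Lemma nball_cantor_baireE s x y :
  nball (prod_space cantor_space baire_space) s (x, y) <->
  close (entry s 1) x (fun i => entry (entry (entry s 0) 0) i != 0) &&
  close (entry s 1) y (entry (entry (entry s 0) 1)).
Proof. by rewrite /nball /= gt_max !seq_dist_lt. Qed.

(** In the discrete metric a ball is empty for radius 0, the centre alone for a positive radius up
    to 1, and the whole space beyond. *)
Definition close2 (s n m : nat) : bool :=
  (0 < entry (entry s 1) 0) &&
  ((entry (entry s 1) 0 <= (entry (entry s 1) 1).+1) ==>
   ((n == entry (entry s 0) 0) && (m == entry (entry s 0) 1))).

Lemma nball_omega2E s n m :
  nball (prod_space omega_space omega_space) s (n, m) <-> close2 s n m.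
Proof.
have E (b : bool) e : ((b%:R : rat) < qrat e)%R =
    (0 < entry e 0) && ((entry e 0 <= (entry e 1).+1) ==> ~~ b).
  rewrite /qrat ltr_pdivlMr ?ltr0n // -natrM ltr_nat.
  by case: b => /=; lia.
rewrite /nball /= gt_max !E /close2 !negbK.
by case: (0 < _) => //=; case: (_ <= _).
Qed.

Definition point2 (n m : nat) : nat :=
  seqcode [:: seqcode [:: n; m]; seqcode [:: 1; 0]].

Lemma close2_point2 a b n m : close2 (point2 a b) n m = (n == a) && (m == b).
Proof. by rewrite /close2 /point2 !entry_seqcode. Qed.

Lemma entry0 i : entry 0 i = 0.
Proof. exact: entry_ge. Qed.

(** Since 0 codes no sequence, it denotes a ball of radius 0; this is the filler in enumerations of
    balls. *)
Lemma close20 n m : close2 0 n m = false.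
Proof. by rewrite /close2 !entry0. Qed.

Lemma close_radius (T : eqType) m (x y : nat -> T) :
  reflect (forall k, k <= m -> x k = y k) (close (seqcode [:: 1; m]) x y).
Proof.
apply: (iffP (closeP _ _ _)); rewrite !entry_seqcode /=.
  by move=> [_ h] k km; apply: h; rewrite mul1n ltnS.
by move=> h; split=> // k; rewrite mul1n ltnS; apply: h.
Qed.

(** A cylinder on the coordinates up to [m k] is a ball of radius 1/(m k + 1); indices outside [R]
    contribute the empty ball. *)
Lemma Sigma01_cylinders (R : nat -> bool) (m a c : nat -> nat) :
  recursiveb R -> recursive m -> recursive a -> recursive c ->
  @Sigma01 (prod_space cantor_space baire_space)
    [set z | exists2 k, R k & forall i, i <= m k ->
       z.1 i = (entry (a k) i != 0) /\ z.2 i = entry (c k) i].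
Proof.
move=> rR rm ra rcc.
exists (fun k => if R k
  then seqcode [:: seqcode [:: a k; c k]; seqcode [:: 1; m k]] else 0).
  by change (recursive (fun k => if R k
    then seqcode [:: seqcode [:: a k; c k]; seqcode [:: 1; m k]] else 0)); prove_rc.
apply/seteqP; split=> -[x y] /= [k].
  move=> Rk h; exists k => //; rewrite Rk; apply/nball_cantor_baireE.
  rewrite !entry_seqcode /=.
  by apply/andP; split; apply/close_radius => i /h[].
case: ifP => [Rk _|_ _ /nball_cantor_baireE]; last first.
  by rewrite /close !entry0.
move=> /nball_cantor_baireE; rewrite !entry_seqcode /=.
move=> /andP[/close_radius hx /close_radius hy].
by exists k => // i im; split; [apply: hx|apply: hy].
Qed.

(** As [Q] at [k] consults only coordinates up to [u k], its failure is witnessed by finite initial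
    segments, so the failing pairs form a recursive union of cylinders. *)
Lemma Sigma11_forall (Q : cantor -> baire -> nat -> bool) (u : nat -> nat) :
  recursive u ->
  recursiveb (fun t =>
    Q (fun i => entry (p1 (p2 t)) i != 0) (entry (p2 (p2 t))) (p1 t)) ->
  (forall x x' y y' k, (forall i, i <= u k -> x i = x' i) ->
     (forall i, i <= u k -> y i = y' i) -> Q x y k = Q x' y' k) ->
  @Sigma11 cantor_space [set x | exists y, forall k, Q x y k].
Proof.
move=> ru rQ useQ.
exists [set z : prod_space cantor_space baire_space | forall k, Q z.1 z.2 k] => //.
rewrite /Pi01.
have := @Sigma01_cylinders (fun t => ~~ Q (fun i => entry (p1 (p2 t)) i != 0)
  (entry (p2 (p2 t))) (p1 t)) (fun t => u (p1 t)) (fun t => p1 (p2 t))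
  (fun t => p2 (p2 t)).
move=> /(_ ltac:(prove_rc) ltac:(prove_rc) ltac:(prove_rc) ltac:(prove_rc)).
congr Sigma01; apply/seteqP; split=> -[x y] /=.
  move=> [t nQ h] /(_ (p1 t)); apply/negP; apply: contraNN nQ.
  by rewrite (useQ _ (fun i => entry (p1 (p2 t)) i != 0) _ (entry (p2 (p2 t)))) //
    => i /h [].
move=> /existsNP[k nQ].
(* The witness consists of [k] and the segments of [x] and [y] consulted there. *)
pose pre (z : nat -> nat) := seqcode (mkseq z (u k).+1).
exists (pr k (pr (pre (fun i => x i : nat)) (pre y))); rewrite !(p1_pr, p2_pr).
  apply/negP => h; apply: nQ; apply: etrans h; apply: useQ => i iu.
    by rewrite entry_mkseq //; case: (x i).
  by rewrite entry_mkseq.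
by move=> i iu; rewrite !entry_mkseq //; case: (x i).
Qed.

(* A point [z] of [baire] encodes the pair of [fun k => p1 (z k) != 0] in
   [cantor] and [fun k => p2 (z k)] in [baire]. *)
Definition bit (v : nat) : bool := p1 v != 0.

(** The complement of the closed matrix is a union of balls. A node of length [n] is discarded when
    it already lies in one of the first [n] balls, among those whose membership depends on
    coordinates below [n] only. *)
Lemma Sigma11_tree (A : set cantor) : @Sigma11 cantor_space A ->
  exists2 T : nat -> nat -> bool, recursiveb2 T &
    forall x, A x <-> exists2 z : baire, x = bit \o z &
                        forall n, T n (seqcode (mkseq z n)).
Proof.
move=> [C [eps reps Ce] ->].
have {Ce}CE x y : C (x, y) <-> forall m, ~~
    (close (entry (eps m) 1) x (fun i => entry (entry (entry (eps m) 0) 0) i != 0) &&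
     close (entry (eps m) 1) y (entry (entry (entry (eps m) 0) 1))).
  transitivity (~ (~` C) (x, y)); first by split=> [h /(_ h)//|/contrapT].
  rewrite Ce; split=> [h m|h [m _ /nball_cantor_baireE]]; last exact/negP.
  by apply/negP => /nball_cantor_baireE hb; apply: h; exists m.
pose cl n (x : cantor) (y : baire) :=
  bforall n (fun m => (entry (eps m) 1 < n) ==> ~~
    (close (entry (eps m) 1) x (fun i => entry (entry (entry (eps m) 0) 0) i != 0) &&
     close (entry (eps m) 1) y (entry (entry (entry (eps m) 0) 1)))).
exists (fun n p => cl n (bit \o entry p) (p2 \o entry p)).
  apply: rc2_uncurried; rewrite /cl /close /bit /=.
  prove_rc.
have clE z n : cl n (bit \o entry (seqcode (mkseq z n)))
    (p2 \o entry (seqcode (mkseq z n))) = cl n (bit \o z) (p2 \o z).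
  rewrite /cl /bforall; apply: eq_in_all => m _.
  case: ltnP => //= en.
  by congr (~~ (_ && _)); apply: close_eq => // k ke /=; rewrite entry_mkseq //;
    apply: leq_ltn_trans en.
move=> x; split=> /= [[y /CE Cxy]|[z -> hz]].
  pose z k := pr (x k) (y k).
  have xz : bit \o z = x.
    by apply/funext => k; rewrite /z /bit /= p1_pr; case: (x k).
  have yz : p2 \o z = y by apply/funext => k; rewrite /z /= p2_pr.
  exists z => // n; rewrite clE xz yz; apply/bforallP => m _.
  by rewrite Cxy implybT.
exists (p2 \o z); apply/CE => m.
(* Long enough for ball [m] to be both listed and decided. *)
pose n := (maxn m (entry (eps m) 1)).+1.
have := hz n; rewrite clE => /bforallP /(_ m).
by rewrite ltnS leq_maxl ltnS leq_maxr => /(_ isT).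
Qed.

(** * Sets with a recursive semi-positive code *)

Lemma app_graphE a n y : app_graph a n y <->
  forall s, close (entry s 1) y (entry (entry s 0)) <->
            exists m, close2 (a m) n s.
Proof.
split=> h s; have := h s; rewrite nball_baireE => hs.
  apply: (iff_trans hs); split=> [[m _ /nball_omega2E]|[m /nball_omega2E]];
  by exists m.
apply: (iff_trans hs); split=> [[m /nball_omega2E]|[m _ /nball_omega2E]];
by exists m.
Qed.

Lemma app_graph_app a n : app_defined a n -> app_graph a n (app a n).
Proof. by move=> [y [gy _]]; apply: xgetPex; exists y. Qed.

Lemma app_graph_unique a n y : app_defined a n -> app_graph a n y -> y = app a n.
Proof.
move=> /[dup] /app_graph_app ga [z [_ uz]] gy.
by rewrite -(uz _ gy) -(uz _ ga).
Qed.

Lemma SPC_stage_SPC R xi a : well_order R -> SPC_stage R xi a -> SPC a.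
Proof. by move=> wR h; exists R; split=> //; exists xi. Qed.

(** Induction along the tree of a code, with the well-ordering and the stages hidden. *)
Lemma SPC_rec (P : baire -> Prop) :
  (forall a, a 0 = 0 -> P a) ->
  (forall a, a 0 = 1 ->
     (forall i j, app_defined (star a) (seqcode [:: i; j])) ->
     (forall i j, SPC (app (star a) (seqcode [:: i; j]))) ->
     (forall i j, P (app (star a) (seqcode [:: i; j]))) -> P a) ->
  forall a, SPC a -> P a.
Proof.
move=> P0 P1 a [R [wR [xi]]]; elim=> {xi a} [xi a _ /P0 //|].
move=> xi a eta _ a1 da _ sa Pa; apply: P1 => // i j.
exact: SPC_stage_SPC (sa i j).
Qed.

Lemma SPC_cases a : SPC a -> a 0 = 0 \/
  [/\ a 0 = 1, forall i j, app_defined (star a) (seqcode [:: i; j]) &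
      forall i j, SPC (app (star a) (seqcode [:: i; j]))].
Proof. by elim/SPC_rec => {}a *; [left|right]. Qed.

Lemma leq_well_order : well_order leq.
Proof.
apply: antisymmetric_well_order; first exact: anti_leq.
move=> A exA; have [z Az zmin] := ex_minnP exA.
by exists z; split=> // x /zmin.
Qed.

Lemma SPC_leaf a : a 0 = 0 -> SPC a.
Proof.
move=> a0; exists leq; split; first exact: leq_well_order.
by exists 0; apply: SPC_zero => // e []; case: e.
Qed.

(** The successor reserves 0 for the root and makes every child larger than its parent. *)
Definition child (u i j : nat) : nat := (pr u (pr i j)).+1.

Definition Vb (t : nat) (x : cantor) : bool := (t == 1) || ((1 < t) && x (t - 2)).

Lemma VbP t x : Vset t x <-> Vb t x.
Proof. by case: t => [|[|t]] //=; rewrite /Vb /= subn2. Qed.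

(* [y] encodes labels [cod u : baire] of nodes [u], truth values [val u], and
   witnesses: [ci] and [cj] choose the [i] or the [j] by which the label of [u]
   is true or false, and [wit v s] the ball containing [(n, s)] when [cod v] is
   [app (star (cod u)) n] and [cod v] lies in the ball [s]. *)
Definition slot (y : baire) (a b c : nat) : nat := y (pr a (pr b c)).
Definition cod (y : baire) (u t : nat) : nat := slot y 0 u t.
Definition val (y : baire) (u : nat) : bool := slot y 1 u 0 != 0.
Definition ci (y : baire) (u : nat) : nat := slot y 2 u 0.
Definition cj (y : baire) (u i : nat) : nat := slot y 3 u i.
Definition wit (y : baire) (v s : nat) : nat := slot y 4 v s.

(** The last two clauses say that [cod y v] has the graph demanded by [app]. Values of [y] are named
    by the indices [i], [j], [m], [t], so that [y] is never applied to its own values and each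
    instance consults [y] at arguments bounded by the indices. *)
Definition evaluation (a : baire) (b : bool) (x : cantor) (y : baire)
    (u i j s m t : nat) : bool :=
  let v := child u i j in
  let n := seqcode [:: i; j] in
  [&& cod y 0 t == a t,
      val y 0 == b,
      (cod y u 0 == 0) && (cod y u 2 == t) ==> (val y u == Vb t x),
      [&& cod y u 0 == 1, val y u & ci y u == i] ==> val y v,
      [&& cod y u 0 == 1, ~~ val y u & cj y u i == j] ==> ~~ val y v,
      [&& cod y u 0 == 1, wit y v s == m,
          close (entry s 1) (cod y v) (entry (entry s 0)) &
          cod y u m.+1 == t] ==> close2 t n s &
      [&& cod y u 0 == 1, cod y u m.+1 == t & close2 t n s] ==>
          close (entry s 1) (cod y v) (entry (entry s 0))].

(** Induction on the code: uniqueness in [app_defined] forces the labels of the children, and the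
    choices [ci] and [cj] then force the truth values. *)
Lemma evaluation_sound a b x y :
  (forall u i j s m t, evaluation a b x y u i j s m t) -> SPC a ->
  tau a x <-> b.
Proof.
move=> ev SPCa.
have tauE : forall g, SPC g -> forall u, cod y u = g -> (tau g x <-> val y u).
  apply: SPC_rec => g.
    move=> g0 u gE; have /and5P[_ _ h _ _] := ev u 0 0 0 0 (g 2).
    rewrite tau0 //; move: h; rewrite gE g0 !eqxx /= => /eqP ->.
    exact: VbP.
  move=> g1 dg _ IH u gE.
  have E i j : cod y (child u i j) = app (star g) (seqcode [:: i; j]).
    apply: app_graph_unique; first exact: dg.
    apply/app_graphE => s; split.
      move=> h; exists (wit y (child u i j) s).
      have := ev u i j s (wit y (child u i j) s) (g (wit y (child u i j) s).+1).
      by move=> /and5P[_ _ _ _ /and3P[_]]; rewrite gE g1 !eqxx h.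
    move=> [m]; rewrite /star => h.
    have := ev u i j s m (g m.+1).
    by move=> /and5P[_ _ _ _ /and3P[_ _]]; rewrite gE g1 !eqxx h.
  rewrite tau1 //; split=> [[i _ h]|vu].
    case: (boolP (val y u)) => // nvu; exfalso.
    have := ev u i (cj y u i) 0 0 0 => /and5P[_ _ _ _ /and3P[+ _ _]].
    rewrite gE g1 nvu !eqxx /= => /negP; apply.
    by apply/(IH i _ _ (E _ _))/h.
  exists (ci y u) => // j _; apply/(IH _ _ _ (E _ _)).
  by have := ev u (ci y u) j 0 0 0 => /and5P[_ _ _ + _]; rewrite gE g1 vu !eqxx.
have aE : cod y 0 = a.
  by apply/funext => t; have /and5P[/eqP] := ev 0 0 0 0 0 t.
rewrite (tauE a SPCa 0 aE).
by have /and5P[_ /eqP -> _ _ _] := ev 0 0 0 0 0 0.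
Qed.

Lemma evaluation_complete a (b : bool) x : SPC a -> (tau a x <-> b) ->
  exists y, forall u i j s m t, evaluation a b x y u i j s m t.
Proof.
move=> SPCa tab.
(* [n] is fuel, and [u.+1] units suffice for [u]. Below a leaf all labels are the zero sequence,
   itself a code, so that every label lies in [SPC]. *)
pose lab := fix lab n u : baire :=
  if n is n'.+1 then if u is u'.+1 then
    let g := lab n' (p1 u') in
    if g 0 == 1 then app (star g) (seqcode [:: p1 (p2 u'); p2 (p2 u')])
    else (fun=> 0) else a else (fun=> 0).
pose beta u := lab u.+1 u.
have p1_le u : p1 u <= u by rewrite leq_subr.
have labE n u : u < n -> lab n u = beta u.
  suff H k : forall n u, u < n -> u < k -> lab n u = lab k u.
    by move=> un; apply: H.
  elim: k => // k IH {}n {}u; case: n => // n; case: u => //= u.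
  rewrite !ltnS => un uk; rewrite (IH n (p1 u)) //.
    exact: leq_ltn_trans un.
  exact: leq_ltn_trans uk.
have betaS v : beta v.+1 = if beta (p1 v) 0 == 1
    then app (star (beta (p1 v))) (seqcode [:: p1 (p2 v); p2 (p2 v)])
    else fun=> 0.
  have labS n : lab n.+1 v.+1 = if lab n (p1 v) 0 == 1
    then app (star (lab n (p1 v))) (seqcode [:: p1 (p2 v); p2 (p2 v)])
    else fun=> 0 by [].
  by rewrite {1}/beta labS labE // ltnS.
have SPCbeta u : SPC (beta u).
  have [n] := ubnP u; elim: n u => // n IH [|u] un; first exact: SPCa.
  rewrite betaS; case: eqP => [b1|_]; last exact: SPC_leaf.
  have [|b0|[_ _]] := @SPC_cases (beta (p1 u)); last by apply.
    by apply: IH; apply: leq_ltn_trans (p1_le u) _.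
  by rewrite b0 in b1.
have betaC u i j : beta u 0 = 1 ->
    beta (child u i j) = app (star (beta u)) (seqcode [:: i; j]).
  by rewrite /child betaS !(p1_pr, p2_pr) => ->.
pose V u := `[< tau (beta u) x >].
have /choice[I IP] u : exists i, beta u 0 = 1 -> V u -> forall j, V (child u i j).
  have [b1|nb1] := pselect (beta u 0 = 1); last by exists 0.
  have [/asboolP Vu|nVu] := boolP (V u); last by exists 0.
  move: Vu; rewrite tau1 // => -[i _ h]; exists i => _ _ j.
  by apply/asboolP; rewrite betaC //; apply: h.
have /choice[J JP] (q : nat * nat) : exists j, beta q.1 0 = 1 -> ~~ V q.1 ->
    ~~ V (child q.1 q.2 j).
  case: q => u i /=.
  have [b1|nb1] := pselect (beta u 0 = 1); last by exists 0.
  have [h|/existsNP[j /negP h]] := pselect (forall j, V (child u i j));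
    last by exists j.
  exists 0 => _ /asboolP []; rewrite tau1 //; exists i => // j _.
  by rewrite /= -betaC //; apply/asboolP/h.
(* A node other than 0 determines its parent and its indices, so one witness serves all the
   equations [q.1 = child u i j]. *)
have /choice[W WP] (q : nat * nat) : exists m, forall u i j,
    q.1 = child u i j -> beta u 0 = 1 ->
    close (entry q.2 1) (beta q.1) (entry (entry q.2 0)) ->
    close2 (beta u m.+1) (seqcode [:: i; j]) q.2.
  case: q => -[|v] s /=; first by exists 0.
  pose u := p1 v; pose i := p1 (p2 v); pose j := p2 (p2 v).
  have [[b1 h]|nh] := pselect (beta u 0 = 1 /\
      close (entry s 1) (beta v.+1) (entry (entry s 0))); last first.
    exists 0 => u' i' j' [vE] b1 h; case: nh; split=> //.
    by rewrite /u vE p1_pr.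
  have [b0|[_ db _]] := SPC_cases (SPCbeta u); first by rewrite b0 in b1.
  have := app_graph_app (db i j); rewrite app_graphE => /(_ s) [+ _].
  rewrite betaS b1 eqxx in h => /(_ h) [m hm].
  exists m => u' i' j' [vE] _ _; move: hm.
  by rewrite /u /i /j vE !(p1_pr, p2_pr).
pose y q := let u := p1 (p2 q) in let c := p2 (p2 q) in
  match p1 q with
  | 0 => beta u c | 1 => V u : nat | 2 => I u | 3 => J (u, c) | _ => W (u, c)
  end.
have yc u : cod y u = beta u.
  by apply/funext => t; rewrite /cod /slot /y !(p1_pr, p2_pr).
have yv u : val y u = V u.
  by rewrite /val /slot /y !(p1_pr, p2_pr); case: (V u).
have yi u : ci y u = I u by rewrite /ci /slot /y !(p1_pr, p2_pr).
have yj u i : cj y u i = J (u, i) by rewrite /cj /slot /y !(p1_pr, p2_pr).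
have yw v s : wit y v s = W (v, s) by rewrite /wit /slot /y !(p1_pr, p2_pr).
exists y => u i j s m t; rewrite /evaluation !(yc, yv, yi, yj, yw).
apply/and5P; split=> //.
- apply/eqP; apply/idP/idP => [/asboolP/tab //|/tab h].
  exact/asboolP.
- apply/implyP => /andP[/eqP b0 /eqP <-].
  apply/eqP; apply/idP/idP; rewrite /V.
    by move=> /asboolP; rewrite tau0 // => /VbP.
  by move=> h; apply/asboolP; rewrite tau0 //; apply/VbP.
- by apply/implyP => /and3P[/eqP b1 Vu /eqP <-]; apply: IP.
apply/and3P; split.
- by apply/implyP => /and3P[/eqP b1 Vu /eqP <-]; apply: (JP (u, i)).
- apply/implyP => /and4P[/eqP b1 /eqP <- h /eqP <-].
  by apply: (WP (child u i j, s)) => //.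
- apply/implyP => /and3P[/eqP b1 /eqP <- h].
  have [b0|[_ db _]] := SPC_cases (SPCbeta u); first by rewrite b0 in b1.
  have := app_graph_app (db i j); rewrite -betaC // app_graphE => /(_ s) [_].
  by apply; exists m.
Qed.

(** [pr] is monotone, so [pr N (pr N N)] bounds every slot consulted; the summand 4 is the largest
    tag of a slot. *)
Lemma evaluation_use a b x x' y y' u i j s m t (N : nat) :
  u + i + j + s + m + t + child u i j + 4 <= N ->
  (forall k, k <= pr N (pr N N) -> x k = x' k) ->
  (forall k, k <= pr N (pr N N) -> y k = y' k) ->
  evaluation a b x y u i j s m t = evaluation a b x' y' u i j s m t.
Proof.
move=> hN hx hy.
have E p q r : p <= N -> q <= N -> r <= N -> slot y p q r = slot y' p q r.
  by move=> pN qN rN; apply: hy; rewrite pr_le // pr_le.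
have Ec : close (entry s 1) (cod y (child u i j)) (entry (entry s 0)) =
          close (entry s 1) (cod y' (child u i j)) (entry (entry s 0)).
  apply: close_eq => // k ks; apply: E; have := entry_le s 1; lia.
have Ev : Vb t x = Vb t x'.
  rewrite /Vb hx //.
  rewrite (leq_trans _ (le_pr2 _ _)) // (leq_trans _ (le_pr2 _ _)) //; lia.
rewrite /evaluation Ec Ev /cod /val /ci /cj /wit !E //; lia.
Qed.

(** The two values of [b] yield the coded set and its complement. *)
Lemma SPC_Sigma11 a (b : bool) : recursive a -> SPC a ->
  @Sigma11 cantor_space [set x | tau a x <-> b].
Proof.
move=> ra SPCa.
pose ev x y k := evaluation a b x y (p1 (p1 k)) (p1 (p2 (p1 k))) (p2 (p2 (p1 k)))
  (p1 (p1 (p2 k))) (p2 (p1 (p2 k))) (p2 (p2 k)).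
pose N k := p1 (p1 k) + p1 (p2 (p1 k)) + p2 (p2 (p1 k)) +
  p1 (p1 (p2 k)) + p2 (p1 (p2 k)) + p2 (p2 k) +
  child (p1 (p1 k)) (p1 (p2 (p1 k))) (p2 (p2 (p1 k))) + 4.
have := @Sigma11_forall ev (fun k => pr (N k) (pr (N k) (N k))).
have rN : recursive N by rewrite /N /child; prove_rc.
move=> /(_ ltac:(prove_rc)).
have rev : recursiveb (fun t => ev (fun i => entry (p1 (p2 t)) i != 0)
    (entry (p2 (p2 t))) (p1 t)).
  rewrite /ev /evaluation /cod /val /ci /cj /wit /slot /child /Vb /close /close2.
  prove_rc.
move=> /(_ rev) H.
have {}H := H (fun x x' y y' k =>
  @evaluation_use a b x x' y y' _ _ _ _ _ _ (N k) (leqnn _)).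
congr Sigma11: H; apply/seteqP; split=> x /=.
  move=> [y hy]; apply: (@evaluation_sound a b x y) => // u i j s m t.
  by have := hy (pr (pr u (pr i j)) (pr (pr s m) t)); rewrite /ev !(p1_pr, p2_pr).
by move=> /(evaluation_complete SPCa)[y hy]; exists y => k; apply: hy.
Qed.

(** * Separation by bar recursion *)

Lemma well_order_anti (T : eqType) (R : rel T) : well_order R -> antisymmetric R.
Proof.
move=> wR x y /andP[xy yx].
have refl z : R z z.
  have [|m [[/eqP -> h] _]] := wR (pred1 z); last by apply: h; rewrite !inE.
  by exists z; rewrite inE.
(* Both [x] and [y] are least in the set of these two, and least elements are unique. *)
have [|m [_ um]] := wR (pred2 x y); first by exists x; rewrite !inE eqxx.
rewrite -(um x); first apply: um.
  by split=> [|z]; rewrite !inE ?eqxx ?orbT // => /orP[] /eqP ->.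
by split=> [|z]; rewrite !inE ?eqxx // => /orP[] /eqP ->.
Qed.

(** Sums are formed on the natural numbers themselves: [k] assigns to each number its summand. *)
Definition lex_rel (k : nat -> nat) (R1 : rel nat) (R2 : nat -> rel nat) :
    rel nat :=
  fun m n => if k m == k n then R2 (k m) m n else R1 (k m) (k n).

Lemma lex_well_order k R1 R2 : well_order R1 -> (forall c, well_order (R2 c)) ->
  well_order (lex_rel k R1 R2).
Proof.
move=> w1 w2; apply: antisymmetric_well_order => [m n|B [b Bb]].
  rewrite /lex_rel [k n == k m]eq_sym; case: eqP => [<-|kmn].
    exact: well_order_anti.
  by move=> /(well_order_anti w1).
have [|c [[/asboolP[n Bn kn] cmin] _]] :=
    w1 (fun c => `[< exists2 n, n \in B & k n = c >]).
  by exists (k b); apply/asboolP; exists b.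
have [|z [[/andP[Bz /eqP kz] zmin] _]] := w2 c [pred n in B | k n == c].
  by exists n; rewrite inE /= Bn kn eqxx.
exists z; split=> // x Bx; rewrite /lex_rel kz; case: eqP => [cx|_].
  by apply: zmin; rewrite inE /= Bx -cx eqxx.
by apply: cmin; apply/asboolP; exists x.
Qed.

Lemma SPC_stage_homo (R R' : rel nat) (phi : nat -> nat) xi a :
  (forall e f, strictly_below R e f -> strictly_below R' (phi e) (phi f)) ->
  (forall f, (forall e, ~ strictly_below R e f) ->
             forall e, ~ strictly_below R' e (phi f)) ->
  SPC_stage R xi a -> SPC_stage R' (phi xi) a.
Proof.
move=> mono bot; elim=> {xi a} [xi a xi0 a0|xi a eta [zeta zxi] a1 da etaxi _ IH].
  by apply: SPC_zero a0; apply: bot.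
apply: (SPC_pos (eta := fun i j => phi (eta i j))) => // [|i j].
  by exists (phi zeta); apply: mono.
exact: mono.
Qed.

(* The stages of the successors are put side by side in the lexicographic sum
   of their well-orderings, with a common least element [0] below the sum and a
   new greatest element [1] above it. *)
Lemma SPC_node a : a 0 = 1 ->
  (forall i j, app_defined (star a) (seqcode [:: i; j])) ->
  (forall i j, SPC (app (star a) (seqcode [:: i; j]))) -> SPC a.
Proof.
move=> a1 da SPCa.
have /choice[R] c : exists R : rel nat, well_order R /\ exists xi,
    SPC_stage R xi (app (star a) (seqcode [:: p1 c; p2 c])) by exact: SPCa.
move=> /all_and2[wR] /choice[xi Sxi].
(* Bottom is 0 and top is 1; in between, [(pr c e).+2] stands for the element [e] of the order
   [R c]. As [pr] is not onto, a last comparison by [leq] breaks ties. *)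
pose tier n := if n is n'.+1 then (if n' is 0 then 2 else 1) else 0.
pose R' := lex_rel tier leq (fun=> lex_rel (fun n => p1 n.-2) leq
  (fun c => lex_rel (fun n => p2 n.-2) (R c) (fun=> leq))).
have wR' : well_order R'.
  by do !(apply: lex_well_order => // *; try exact: leq_well_order).
have R'0 e : ~ strictly_below R' e 0.
  by case: e => [|[|e]] []; rewrite /R' /lex_rel.
pose least c e := forall f, ~ strictly_below (R c) f e.
(* The least elements of all summands are merged into 0, since [SPC_zero] tolerates nothing below
   its stage. *)
pose phi c e := if `[< least c e >] then 0 else (pr c e).+2.
have stage c : SPC_stage R' (phi c (xi c)) (app (star a) (seqcode [:: p1 c; p2 c])).
  apply: SPC_stage_homo (Sxi c) => [e f ef|f].
    have nf : ~ least c f by move=> /(_ e).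
    rewrite /phi (asboolF nf); case: ifP => _; first by split.
    split; last by move=> [] /(congr1 p2); rewrite !p2_pr => e'; case: ef.
    rewrite /R' /lex_rel /= !(p1_pr, p2_pr) eqxx.
    by case: eqP => [e'|_]; case: ef.
  by move=> fl; rewrite /phi asboolT.
exists R'; split=> //; exists 1.
apply: (SPC_pos (eta := fun i j => phi (pr i j) (xi (pr i j)))) => // [|i j|i j].
- by exists 0; split.
- by rewrite /phi; case: ifP.
- by have := stage (pr i j); rewrite p1_pr p2_pr.
Qed.

(** * Separators on the tree of pairs *)

Section Separation.
Variables T S : nat -> nat -> bool.
Hypothesis rT : recursiveb2 T.
Hypothesis rS : recursiveb2 S.

Notation level := p1 (only parsing).
Notation left u := (p1 (p2 u)) (only parsing).
Notation right u := (p2 (p2 u)) (only parsing).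

(* A node [u = pr n (pr p q)] consists of codes [p] and [q] of sequences of
   length [n], on the sides of [T] and of [S]. *)
Definition extend (u i j : nat) : nat :=
  pr (level u).+1 (pr (snoc (level u) (left u) i) (snoc (level u) (right u) j)).

Definition live (u : nat) : bool :=
  [&& T (level u) (left u), S (level u) (right u) &
      bforall (level u) (fun k =>
        bit (entry (left u) k) ==> bit (entry (right u) k))].

Definition clash (u k : nat) : bool :=
  bit (entry (left u) k) && ~~ bit (entry (right u) k).

(* An index [m] such that [Vset m] separates the two sides of a node that is
   not live. *)
Definition leaf (u : nat) : nat :=
  if T (level u) (left u) then
    if S (level u) (right u) then (find (clash u) (iota 0 (level u))).+2 else 1
  else 0.

(** [t.-1] is read as a triple i, j, s. The point ball listed there puts [s] into the set of balls
    around the successor at (i, j); otherwise the empty ball 0 is listed. At a dead node the copy of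
    [leaf u] at position 2 is the one that [tau] reads. *)
Definition sep_step (g : nat -> nat -> nat) (u t : nat) : nat :=
  if t == 0 then nat_of_bool (live u) else
  if live u then
    let s := p2 t.-1 in
    if close (entry s 1) (g (extend u (p1 (p1 t.-1)) (p2 (p1 t.-1))))
         (entry (entry s 0))
    then point2 (seqcode [:: p1 (p1 t.-1); p2 (p1 t.-1)]) s else 0
  else leaf u.

(** Membership in the ball [s] consults coordinates up to [entry s 1], which is at most [s], hence
    below [t]. *)
Lemma sep_step_eq g g' u t :
  (forall k, k < t -> g (extend u (p1 (p1 t.-1)) (p2 (p1 t.-1))) k =
                      g' (extend u (p1 (p1 t.-1)) (p2 (p1 t.-1))) k) ->
  sep_step g u t = sep_step g' u t.
Proof.
rewrite /sep_step; case: t => //= t gg'; case: ifP => // _.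
rewrite (@close_eq _ _ _ (g' (extend u (p1 (p1 t)) (p2 (p1 t)))) _
  (entry (entry (p2 t) 0))) // => k hk.
by apply: gg'; have := entry_le (p2 t) 1; have := p2_le t; lia.
Qed.

Fixpoint sep_iter (n u : nat) : baire :=
  if n is n'.+1 then sep_step (sep_iter n') u else fun=> 0.

(* The value at [t] depends on values of the successors below [t] only, so the
   recursion terminates even below nodes where the tree is not well founded. *)
Definition sep (u t : nat) : nat := sep_iter t.+1 u t.

Lemma sepE u t : sep u t = sep_step sep u t.
Proof.
have stab n m v k : k < n -> k < m -> sep_iter n v k = sep_iter m v k.
  elim: n m v k => // n IH [//|m] v k; rewrite !ltnS => kn km /=.
  by apply: sep_step_eq => l lk; apply: IH; apply: leq_trans lk _.
by apply: sep_step_eq => k kt; apply: stab.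
Qed.

Lemma rb_live f : recursive f -> recursiveb (fun n => live (f n)).
Proof. by move=> rf; rewrite /live /bit; prove_rc. Qed.

Lemma rc_leaf f : recursive f -> recursive (fun n => leaf (f n)).
Proof.
apply: (rc_comp (f := leaf)).
have rfind : recursive (fun u => find (clash u) (iota 0 (level u))).
  (* Without a clash [find] returns the length of the list, hence the first alternative. *)
  apply: (@rc_min (fun u k => (level u <= k) || clash u k)) => [|u|u k].
  - by apply: rc2_uncurried; rewrite /clash /bit; prove_rc.
  - have [h|h] := boolP (has (clash u) (iota 0 (level u))).
      have := nth_find 0 h; rewrite nth_iota ?add0n => [->|]; first by rewrite orbT.
      by have := h; rewrite has_find size_iota.
    by rewrite hasNfind // size_iota leqnn.
  - move=> /orP[h|h]; first by rewrite (leq_trans (find_size _ _)) // size_iota.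
    rewrite leqNgt; apply/negP => lt; have := before_find 0 lt.
    have := leq_trans lt (find_size _ _); rewrite size_iota => kl.
    by rewrite nth_iota // add0n h.
by rewrite /leaf; prove_rc.
Qed.

Lemma rc_sep u : recursive (sep u).
Proof.
suff r : recursive (fun e => sep (p1 e) (p2 e)).
  have := rc_comp r (rc_pr (rc_const u) rc_id).
  by apply: recursive_fun_ext => x; rewrite p1_pr p2_pr.
pose e' e := (p2 e).-1.
pose c e k := pr (extend (p1 e) (p1 (p1 (e' e))) (p2 (p1 (e' e)))) k.
(* The rank of the pair of [u] and [t] is [t], and its calls are the values below [t] at one
   successor; the predecessor undoes the shift in the table. *)
apply: (@rc_wf _ p2 p2 c
  (fun e w => sep_step (fun v k => (entry w (pr v k)).-1) (p1 e) (p2 e))).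
- by prove_rc.
- by apply: rc2_uncurried; rewrite /c /e' /extend; prove_rc.
- apply: rc2_uncurried; have H := rb_live; have H' := rc_leaf.
  by rewrite /sep_step /point2 /close /extend; prove_rc.
- by move=> e k ke; rewrite /c p2_pr.
- move=> e w h; rewrite sepE; apply: sep_step_eq => k ke.
  by have := h k ke; rewrite /c /e' => ->; rewrite p1_pr p2_pr.
Qed.

Lemma close_sep (x y : baire) :
  (forall s, close (entry s 1) x (entry (entry s 0)) <->
             close (entry s 1) y (entry (entry s 0))) -> x = y.
Proof.
move=> h; apply/funext => k.
have := h (seqcode [:: seqcode (mkseq y k.+1); seqcode [:: 1; k]]).
rewrite !entry_seqcode /= => -[_ /(_ _)].
have E : close (seqcode [:: 1; k]) y (entry (seqcode (mkseq y k.+1))).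
  by apply/close_radius => i ik; rewrite entry_mkseq.
by move=> /(_ E) /close_radius /(_ k (leqnn k)) ->; rewrite entry_mkseq.
Qed.

Lemma app_graph_sep u i j y : live u ->
  app_graph (star (sep u)) (seqcode [:: i; j]) y <-> y = sep (extend u i j).
Proof.
move=> lu.
have E s : (exists m, close2 (star (sep u) m) (seqcode [:: i; j]) s) <->
    close (entry s 1) (sep (extend u i j)) (entry (entry s 0)).
  split=> [[m]|h].
    rewrite /star sepE /sep_step /= lu; case: ifP => [h|_]; last by rewrite close20.
    rewrite close2_point2 => /andP[/eqP/seqcode_inj[-> ->] /eqP ->].
    exact: h.
  exists (pr (pr i j) s); rewrite /star sepE /sep_step /= lu !(p1_pr, p2_pr) h.
  by rewrite close2_point2 !eqxx.
rewrite app_graphE; split=> [h|-> s]; last by rewrite E.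
by apply: close_sep => s; rewrite h E.
Qed.

Lemma app_defined_sep u i j : live u ->
  app_defined (star (sep u)) (seqcode [:: i; j]).
Proof.
move=> lu; exists (sep (extend u i j)); split; first exact/app_graph_sep.
by move=> y /app_graph_sep ->.
Qed.

Lemma app_sep u i j : live u ->
  app (star (sep u)) (seqcode [:: i; j]) = sep (extend u i j).
Proof.
by move=> lu; apply/app_graph_sep => //; apply/app_graph_app/app_defined_sep.
Qed.

Lemma sep_live u : live u -> sep u 0 = 1.
Proof. by move=> lu; rewrite sepE /sep_step lu. Qed.

Lemma sep_dead u : ~~ live u -> sep u 0 = 0 /\ star (sep u) 1 = leaf u.
Proof. by move=> /negbTE lu; rewrite /star !sepE /sep_step /= lu. Qed.

(** Oriented so that [Acc successor u] is well-foundedness of the tree of pairs extending [u]. *)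
Definition successor (v u : nat) : Prop :=
  live u /\ exists i j, v = extend u i j.

Lemma SPC_sep u : Acc successor u -> SPC (sep u).
Proof.
elim=> {}u _ IH; have [lu|/sep_dead[u0 _]] := boolP (live u); last exact: SPC_leaf.
apply: SPC_node => [|i j|i j]; first exact: sep_live.
  exact: app_defined_sep.
by rewrite app_sep //; apply: IH; split=> //; exists i, j.
Qed.

Definition node (z w : baire) (n : nat) : nat :=
  pr n (pr (seqcode (mkseq z n)) (seqcode (mkseq w n))).

Lemma extend_node z w n i j z' w' :
  (forall k, k < n -> z' k = z k) -> (forall k, k < n -> w' k = w k) ->
  z' n = i -> w' n = j -> extend (node z w n) i j = node z' w' n.+1.
Proof.
move=> hz hw <- <-; rewrite /extend /node !(p1_pr, p2_pr).
have E (v v' : baire) : (forall k, k < n -> v' k = v k) ->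
    snoc n (seqcode (mkseq v n)) (v' n) = seqcode (mkseq v' n.+1).
  move=> h; rewrite seqcode_mkseqS; congr (snoc n (seqcode _) _).
  by apply/eq_in_map => k; rewrite mem_iota /= => /h.
by rewrite !E.
Qed.

(** At a live node, a branch [z] of T picks the union index [z n], and a branch [w] of S refutes any
    index at the intersection index [w n]. The opposite sequence matters only below [n], so it may
    be altered at [n] to match the other index. *)
Lemma sep_separates u : Acc successor u -> forall z w n, u = node z w n ->
  ((forall m, T m (seqcode (mkseq z m))) -> tau (sep u) (bit \o z)) /\
  ((forall m, S m (seqcode (mkseq w m))) -> ~ tau (sep u) (bit \o w)).
Proof.
elim=> {}u _ IH z w n uE.
have upd (v : baire) i :
    exists v' : baire, (forall k, k < n -> v' k = v k) /\ v' n = i.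
  exists (fun k => if k == n then i else v k); rewrite eqxx; split=> // k kn.
  by rewrite ltn_eqF.
have [lu|du] := boolP (live u).
  rewrite tau1 ?sep_live //; split=> [hT|hS [i _ h]].
    exists (z n) => // j _; rewrite /= app_sep //.
    have [w' [ww' w'n]] := upd w j.
    have E := extend_node (z' := z) (fun _ _ => erefl) ww' erefl w'n.
    apply: (proj1 (IH _ _ z w' n.+1 _)) => //; first by split=> //; exists (z n), j.
    by rewrite uE.
  have := h (w n) I; rewrite /= app_sep //.
  have [z' [zz' z'n]] := upd z i.
  have E := extend_node (w' := w) zz' (fun _ _ => erefl) z'n erefl.
  apply: (proj2 (IH _ _ z' w n.+1 _)) => //; first by split=> //; exists i, (w n).
  by rewrite uE.
have [u0 u1] := sep_dead du; rewrite tau0 // u1.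
have [ln lf rt] : [/\ level u = n, left u = seqcode (mkseq z n) &
    right u = seqcode (mkseq w n)] by rewrite uE /node !(p1_pr, p2_pr).
(* A dead pair with both sides still in their trees must clash. *)
have cl : T (level u) (left u) -> S (level u) (right u) ->
    let k := find (clash u) (iota 0 (level u)) in bit (z k) && ~~ bit (w k).
  move=> Tu Su; move: du; rewrite /live Tu Su /= => nb.
  have hk : has (clash u) (iota 0 (level u)).
    apply: contraNT nb => /hasPn nc; apply/bforallP => k kl.
    by have := nc k; rewrite mem_iota kl /clash negb_and negbK implybE => ->.
  move: (nth_find 0 hk) (hk); rewrite has_find size_iota /=.
  move: (find _ _) => k + lt; rewrite nth_iota // add0n /clash lf rt.
  by rewrite !entry_mkseq -?ln.
rewrite /leaf; split=> h.
  case: ifP => [Tu|]; last by rewrite ln lf h.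
  case: ifP => [Su|//]; by have /andP[] := cl Tu Su.
have Su : S (level u) (right u) by rewrite ln rt.
rewrite Su; case: ifP => [Tu|_ []].
by have /andP[_ /negP] := cl Tu Su.
Qed.

(** If the root were inaccessible, choice would give an infinite path of live pairs, whose limits
    are branches of T and S with comparable bits. *)
Lemma successor_wf (r : nat) : r = node (fun=> 0) (fun=> 0) 0 ->
  (forall z w : baire, (forall m, T m (seqcode (mkseq z m))) ->
     (forall m, S m (seqcode (mkseq w m))) ->
     (forall k, bit (z k) -> bit (w k)) -> False) ->
  Acc successor r.
Proof.
move=> rE noT; apply: contrapT => nAr.
have /choice[f fP] u : exists ij : nat * nat, ~ Acc successor u ->
    live u /\ ~ Acc successor (extend u ij.1 ij.2).
  have [Au|nAu] := pselect (Acc successor u); first by exists (0, 0).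
  apply: contrapT => nij; apply: nAu; constructor => v [lu [i [j ->]]].
  by apply: contrapT => nA; apply: nij; exists (i, j).
pose U := fix U n := if n is n'.+1
  then extend (U n') (f (U n')).1 (f (U n')).2 else r.
pose z n := (f (U n)).1; pose w n := (f (U n)).2.
have UE n : U n = node z w n.
  elim: n => [|n IH]; first by rewrite /= rE.
  by rewrite -(extend_node (z := z) (w := w) (i := z n) (j := w n)) // -IH.
have nAU n : ~ Acc successor (U n).
  by elim: n => // n /fP[].
have lU n : live (node z w n) by rewrite -UE; have [] := fP _ (nAU n).
have {}lU n : [&& T n (seqcode (mkseq z n)), S n (seqcode (mkseq w n)) &
    bforall n (fun k => bit (entry (seqcode (mkseq z n)) k) ==>
                        bit (entry (seqcode (mkseq w n)) k))].
  by have := lU n; rewrite /live /node !(p1_pr, p2_pr).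
apply: (noT z w) => [m|m|k]; try by have /and3P[] := lU m.
have /and3P[_ _ /bforallP /(_ k (ltnSn k))] := lU k.+1.
by rewrite !entry_mkseq // => /implyP.
Qed.

End Separation.

(** * The implications between the three conditions *)

Lemma monotone_SPC (A : set cantor) : @Delta11 cantor_space A -> monotone A ->
  exists alpha, recursive alpha /\ semi_positive_code alpha A.
Proof.
move=> [/Sigma11_tree[T rT AT] /Sigma11_tree[S rS AS]] mA.
pose r := node (fun=> 0) (fun=> 0) 0.
have wf : Acc (successor T S) r.
  (* Here [z] gives a point of [A] below the point outside [A] given by [w], against
     monotonicity. *)
  apply: successor_wf => // z w hT hS zw.
  have /AS : exists2 z', bit \o w = bit \o z' &
      forall n, S n (seqcode (mkseq z' n)).
    by exists w.
  by apply; apply: (mA (bit \o z)); [apply/AT; exists z|exact: zw].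
exists (sep T S r); split; first exact: rc_sep.
split; first exact: SPC_sep.
apply/seteqP; split=> x.
  move=> tx; apply: contrapT => /AS[w xw hS].
  have [_ /(_ hS)] := sep_separates wf (erefl : r = node (fun=> 0) w 0).
  by rewrite -xw.
move=> /AT[z -> hT].
by have [/(_ hT)] := sep_separates wf (erefl : r = node z (fun=> 0) 0).
Qed.

Lemma semi_positive_monotone (A : set cantor) : semi_positive A -> monotone A.
Proof.
elim=> {A} [n|||B _ IH|B _ IH] x y //=; first by move=> xn /(_ n xn).
  by move=> [n _ Bx] xy; exists n => //; apply: IH Bx xy.
by move=> Bx xy n _; apply: IH (Bx n I) xy.
Qed.

Lemma semi_positive_tau a : SPC a -> semi_positive (tau a).
Proof.
elim/SPC_rec => {}a; first move=> a0; last move=> a1 _ _ IH.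
  rewrite tau0 //; case: (star a 1) => [|[|n]] /=.
  - exact: sp_empty.
  - exact: sp_full.
  - exact: sp_cyl.
rewrite tau1 //; apply: sp_bigcup => i; apply: sp_bigcap => j; exact: IH.
Qed.

Lemma SPC_Delta11 a : recursive a -> SPC a -> @Delta11 cantor_space (tau a).
Proof.
move=> ra SPCa; split.
  have := SPC_Sigma11 true ra SPCa; congr Sigma11.
  by apply/seteqP; split=> x /= => [[_ h]|t]; [apply: h|split].
have := SPC_Sigma11 false ra SPCa; congr Sigma11.
by apply/seteqP; split=> x /=; [move=> [h _] /h|move=> nt; split].
Qed.

Theorem corollary1p3 (A : set cantor) :
  ((@Delta11 cantor_space A /\ semi_positive A) <->
   (exists alpha : baire, recursive alpha /\ semi_positive_code alpha A)) /\
  ((exists alpha : baire, recursive alpha /\ semi_positive_code alpha A) <->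
   (@Delta11 cantor_space A /\ monotone A)).
Proof.
have ii_i : (exists alpha, recursive alpha /\ semi_positive_code alpha A) ->
    @Delta11 cantor_space A /\ semi_positive A.
  move=> [a [ra [SPCa <-]]].
  by split; [apply: SPC_Delta11|apply: semi_positive_tau].
split; split.
- by move=> [dA /semi_positive_monotone]; apply: monotone_SPC.
- exact: ii_i.
- by move=> /ii_i[dA /semi_positive_monotone].
- by move=> [dA]; apply: monotone_SPC.
Qed.
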